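(* Let $G$ be a profinite group and $M$ a finite $G$-module, and consider $\varphi^q:H^q_c(G,M^* )\to H^q_d(G,M^* )$ and $\varphi_q:H_q^d(G,M)\to H_q^c(G,M)$. Then: (i) if $\varphi^q$ is surjective then $\varphi_q$ is injective, and if $\varphi_q$ is surjective then $\varphi^q$ is injective; (ii) any two of the following three conditions imply the third: $\varphi_q$ is an isomorphism; $\varphi^q$ is an isomorphism; $H_q^c(G,M)$ is finite.
   Context: For a profinite group $G$ and a discrete $G$-module $M$, $H^q_c(G,M)$ is continuous cohomology (continuous cochains), $H^q_d(G,M)$ is abstract group cohomology (all cochains), and $\varphi^q:H^q_c\to H^q_d$ is induced by inclusion of cochains. For a profinite $G$-module $M$, $H_q^d(G,M)$ is abstract group homology, $H_q^c(G,M)$ is profinite homology (projective resolution of $\hat{\mathbb{Z}}$ by profinite $\hat{\mathbb{Z}}[[G]]$-modules and completed tensor product), and $\varphi_q:H_q^d\to H_q^c$ is induced by a comparison chain map between the resolutions. $M^*=\mathrm{Hom}(M,\mathbb{Q}/\mathbb{Z})$ with the contragredient (left) $G$-action. *)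

(* Defs.v *)
From HB Require Import structures.
From mathcomp Require Import all_boot all_order all_algebra.
From mathcomp Require Import all_classical topology.
Set Implicit Arguments. Unset Strict Implicit. Unset Printing Implicit Defensive.
Import Order.TTheory GRing.Theory Num.Theory.
Local Open Scope classical_set_scope.
Local Open Scope ring_scope.

Record profinite_group := ProfiniteGroup {
  pg_sort :> topologicalType;
  pg_mul : pg_sort -> pg_sort -> pg_sort;
  pg_inv : pg_sort -> pg_sort;
  pg_one : pg_sort;
  pg_mulA : associative pg_mul;
  pg_mul1g : left_id pg_one pg_mul;
  pg_mulVg : left_inverse pg_one pg_inv pg_mul;
  pg_mul_cont : continuous (fun p : pg_sort * pg_sort => pg_mul p.1 p.2);
  pg_inv_cont : continuous pg_inv;
  pg_compact : compact [set: pg_sort];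
  pg_hausdorff : hausdorff_space pg_sort;
  pg_tdisc : totally_disconnected [set: pg_sort] }.

Record fin_gmodule (G : profinite_group) := FinGModule {
  gm_sort :> finZmodType;
  gm_act : G -> gm_sort -> gm_sort;
  gm_actD : forall g x y, gm_act g (x + y) = gm_act g x + gm_act g y;
  gm_act1 : forall m, gm_act (pg_one G) m = m;
  gm_actM : forall g h m, gm_act (pg_mul g h) m = gm_act g (gm_act h m);
  gm_act_cont : forall m m', open [set g | gm_act g m = m'] }.

Section Defs.
Variables (G : profinite_group) (M : fin_gmodule G).

Local Notation "1g" := (pg_one G).
Local Notation act := (@gm_act G M).

(* Elements of G^q are represented as sequences of length q. *)
Definition mergeg (i : nat) (x : seq G) : seq G :=
  take i x ++ pg_mul (nth 1g x i) (nth 1g x i.+1) :: drop i.+2 x.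

Definition popen (q : nat) (A : set (seq G)) : Prop :=
  forall x, size x = q -> A x ->
    exists U : seq (set G), size U = q /\
      (forall i, (i < q)%N -> open (nth setT U i) /\ nth setT U i (nth 1g x i)) /\
      (forall y, size y = q -> (forall i, (i < q)%N -> nth setT U i (nth 1g y i)) -> A y).

Definition pclopen (q : nat) (A : set (seq G)) : Prop :=
  (forall y, A y -> size y = q) /\ popen q A /\ popen q (fun y => size y = q /\ ~ A y).

(* M^* = Hom(M, Q/Z); an element is represented by f : M -> rat that is *)
(* additive modulo Z, and two such are equal iff they agree modulo Z.    *)
Definition intq (r : rat) : Prop := r \is a Num.int.
Definition qz_eq (f f' : M -> rat) : Prop := forall m, intq (f m - f' m).
Definition is_dual (f : M -> rat) : Prop :=
  forall m m', intq (f (m + m') - f m - f m').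

Definition dual_act (g : G) (f : M -> rat) : M -> rat := fun m => f (act (pg_inv g) m).

Definition cochain (q : nat) (c : seq G -> M -> rat) : Prop :=
  forall x, size x = q -> is_dual (c x).
Definition cont_cochain (q : nat) (c : seq G -> M -> rat) : Prop :=
  cochain q c /\ forall x, size x = q -> popen q (fun y => qz_eq (c y) (c x)).

Definition cobound (q : nat) (c : seq G -> M -> rat) (x : seq G) : M -> rat :=
  fun m => dual_act (nth 1g x 0) (c (behead x)) m
         + \sum_(i < q) (-1) ^+ i.+1 * c (mergeg i x) m
         + (-1) ^+ q.+1 * c (take q x) m.

Definition subc (c c' : seq G -> M -> rat) : seq G -> M -> rat :=
  fun x m => c x m - c' x m.

Definition cocycle (q : nat) (c : seq G -> M -> rat) : Prop :=
  forall x, size x = q.+1 -> qz_eq (cobound q c x) (fun=> 0).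

Definition coboundary (P : nat -> (seq G -> M -> rat) -> Prop)
    (q : nat) (c : seq G -> M -> rat) : Prop :=
  match q with
  | 0 => forall x, size x = 0%N -> qz_eq (c x) (fun=> 0)
  | p.+1 => exists b, P p b /\ forall x, size x = q -> qz_eq (c x) (cobound p b x)
  end.

Definition coh_surj (q : nat) : Prop :=
  forall c, cochain q c -> cocycle q c ->
    exists c', cont_cochain q c' /\ cocycle q c' /\ coboundary cochain q (subc c c').
Definition coh_inj (q : nat) : Prop :=
  forall c, cont_cochain q c -> cocycle q c -> coboundary cochain q c ->
    coboundary cont_cochain q c.

(* M is made a right module by m.g = g^-1 m; inhomogeneous bar complex. *)

(* abstract chains: finite formal sums  sum_k m_k [x_k]  in M[G^q]       *)
Definition achain (q : nat) (s : seq (seq G * M)) : Prop :=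
  forall p, p \in s -> size p.1 = q.
Definition acoef (s : seq (seq G * M)) (y : seq G) : M :=
  \sum_(p <- s | `[< p.1 = y >]) p.2.
Definition azero (s : seq (seq G * M)) : Prop := forall y, acoef s y = 0.
Definition aneg (s : seq (seq G * M)) : seq (seq G * M) :=
  [seq (p.1, - p.2) | p <- s].
Definition signm (i : nat) (m : M) : M := if odd i then - m else m.

Definition abound (q : nat) (s : seq (seq G * M)) : seq (seq G * M) :=
  flatten [seq (behead p.1, act (pg_inv (nth 1g p.1 0)) p.2)
               :: [seq (mergeg i p.1, signm i.+1 p.2) | i <- iota 0 q]
               ++ [:: (take q p.1, signm q.+1 p.2)] | p <- s].

Definition acycle (q : nat) (s : seq (seq G * M)) : Prop :=
  achain q s /\ match q with 0 => True | p.+1 => azero (abound p s) end.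
Definition aboundary (q : nat) (s : seq (seq G * M)) : Prop :=
  exists b, achain q.+1 b /\ azero (s ++ aneg (abound q b)).

(* profinite chains: M (x)^ Z^[[G^q]] = M[[G^q]], i.e. M-valued finitely *)
(* additive measures on the clopen subsets of G^q (M finite).            *)
Definition pchain (q : nat) (mu : set (seq G) -> M) : Prop :=
  forall A B, pclopen q A -> pclopen q B -> A `&` B = set0 ->
    mu (A `|` B) = mu A + mu B.

Definition pbound (q : nat) (mu : set (seq G) -> M) (A : set (seq G)) : M :=
  \sum_(sg : {ffun M -> M} | `[< exists g : G, forall m, act (pg_inv g) m = sg m >])
      sg (mu [set x | size x = q.+1 /\ (forall m, act (pg_inv (nth 1g x 0)) m = sg m)
                       /\ A (behead x)])
  + \sum_(i < q) signm i.+1 (mu [set x | size x = q.+1 /\ A (mergeg i x)])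
  + signm q.+1 (mu [set x | size x = q.+1 /\ A (take q x)]).

Definition psub (mu nu : set (seq G) -> M) : set (seq G) -> M :=
  fun A => mu A - nu A.

Definition pcycle (q : nat) (mu : set (seq G) -> M) : Prop :=
  pchain q mu /\
  match q with 0 => True | p.+1 => forall A, pclopen p A -> pbound p mu A = 0 end.
Definition pboundary (q : nat) (mu : set (seq G) -> M) : Prop :=
  exists nu, pchain q.+1 nu /\ forall A, pclopen q A -> mu A = pbound q nu A.

Definition dirac_chain (s : seq (seq G * M)) : set (seq G) -> M :=
  fun A => \sum_(p <- s | `[< A p.1 >]) p.2.

Definition hom_inj (q : nat) : Prop :=
  forall s, acycle q s -> pboundary q (dirac_chain s) -> aboundary q s.
Definition hom_surj (q : nat) : Prop :=
  forall mu, pcycle q mu ->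
    exists s, acycle q s /\ pboundary q (psub mu (dirac_chain s)).

Definition hom_c_finite (q : nat) : Prop :=
  exists (n : nat) (L : nat -> set (seq G) -> M),
    (forall i, (i < n)%N -> pcycle q (L i)) /\
    forall mu, pcycle q mu -> exists2 i, (i < n)%N & pboundary q (psub mu (L i)).

End Defs.

(* Main.v *)
(* The bar complex pairs continuous cocycles with abstract cycles, which gives a
   pairing of A = H^q_c(G, M^* ) with B = H_q^d(G, M) into Q/Z.  Since Q/Z is
   injective, H^q_d(G, M^* ) is the full dual of B; since M is finite, the profinite
   chains are the full dual of the locally constant cochains, so H_q^c(G, M) is the
   full dual of A.  Thus phi^q and phi_q are the two adjoints A -> B^* and B -> A^*,
   and (i) holds because characters separate points.  If A^* is finite and one
   adjoint is bijective, finitely many elements of either group separate the points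
   of the other, so every character is a combination of them and the other adjoint
   is bijective too.  If both adjoints are surjective and A^* is infinite, one finds
   a_n in A and b_n in B with <a_i, b_j> = 0 exactly when i <> j, then y in B with
   <a_n, y> = <a_n, b_n> for all n, namely the formal sum of the b_n.  A character
   of B that kills every b killing almost all a_n, but not y, is <a, -> for some a
   in A; this a kills every b_n, hence also the formal sum y: a contradiction. *)
From HB Require Import structures.
Require Import Defs.
From mathcomp Require Import all_boot all_order all_algebra.
From mathcomp Require Import all_classical topology.
From mathcomp Require Import zify.
Set Implicit Arguments. Unset Strict Implicit. Unset Printing Implicit Defensive.
Import GRing.Theory Num.Theory.
Local Open Scope classical_set_scope.
Local Open Scope ring_scope.

(** * The group Q/Z *)

(** No homology or cohomology group is formed as a quotient: each is a pair of subgroups of an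
    ambient group of functions. Every duality is obtained by prescribing a character on a subgroup
    through representatives and extending it. The prescription is consistent when it vanishes
    wherever the representatives cancel, and this is where orthogonality to cycles or cocycles is
    used. Both sides of the pairing are killed by |M|, so all values lie in the cyclic group of
    order |M|. A character that kills the common kernel of finitely many others is therefore a
    combination of them with coefficients below |M|. This one fact turns finite separation into
    surjectivity and bounds the number of characters in the infinite case. The biorthogonal system
    takes the place of the comparison of cardinals |A| >= |B^*| > |B| >= |A^*| > |A| for infinite
    groups. *)

Definition int_sub : {pred rat} := [pred r : rat | r \is a Num.int].

Lemma int_sub_zmod : zmod_closed int_sub.
Proof. by split=> [|x y]; rewrite !inE ?rpred0 //; apply: rpredB. Qed.

HB.instance Definition _ := GRing.isZmodClosed.Build rat int_sub int_sub_zmod.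

Notation QZ := (Quotient.quot int_sub).

Definition qz : {additive rat -> QZ} := \pi_QZ%qT.

Lemma qz_eq0 r : (qz r = 0) <-> (r \is a Num.int).
Proof.
rewrite -(raddf0 qz); split=> [/eqP|h]; last apply/eqP.
  by rewrite -Quotient.idealrBE subr0.
by rewrite -Quotient.idealrBE subr0.
Qed.

Lemma qz_eqP r r' : (qz r = qz r') <-> (r - r' \is a Num.int).
Proof.
rewrite -qz_eq0 raddfB; split=> [->|/eqP]; first by rewrite subrr.
by rewrite subr_eq0 => /eqP.
Qed.

Lemma qz_repr (t : QZ) : qz (repr t) = t.
Proof. by rewrite /qz /= reprK. Qed.

Lemma qz_div (t : QZ) n : exists t' : QZ, t' *+ n.+1 = t.
Proof.
exists (qz (repr t / n.+1%:R)).
by rewrite -raddfMn -[X in qz X]mulr_natr divfK ?pnatr_eq0 // qz_repr.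
Qed.

Section Torsion.
Variable N : nat.

(** A generator of the torsion of exponent [N.+1] in Q/Z. The exponent is kept as a successor so
    that it is positive and ['I_N.+1] is inhabited. *)
Definition tau : QZ := qz (N.+1%:R^-1).

Lemma tau_tors : tau *+ N.+1 = 0.
Proof.
rewrite -raddfMn -[X in qz X]mulr_natr mulVf ?pnatr_eq0 //.
by apply/qz_eq0; rewrite rpred1.
Qed.

Lemma tau_eq0 k : tau *+ k = 0 -> (N.+1 %| k)%N.
Proof.
rewrite -raddfMn => /= /qz_eq0 /intrP[z hz].
have h : (k%:Z = z * N.+1%:Z)%R.
  apply: (@intr_inj rat); rewrite intrM -hz -[X in X * _]mulr_natr -!pmulrn.
  by rewrite mulrAC mulVf ?pnatr_eq0 // mul1r.
have : (N.+1%:Z %| k%:Z)%Z by rewrite h dvdz_mull.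
by [].
Qed.

Lemma tors_tau (t : QZ) : t *+ N.+1 = 0 -> exists k : 'I_N.+1, t = tau *+ k.
Proof.
rewrite -(qz_repr t); move: (repr t) => r.
rewrite -raddfMn => /qz_eq0 /intrP[z hz].
have hN : (N.+1%:Z != 0) by [].
have hk : (`|(z %% N.+1%:Z)%Z|%N < N.+1)%N.
  by rewrite -ltz_nat gez0_abs ?modz_ge0 // ltz_mod.
exists (Ordinal hk) => /=; rewrite -raddfMn; apply/qz_eqP.
suff -> : r - N.+1%:R^-1 *+ `|(z %% N.+1%:Z)%Z|%N = (z %/ N.+1%:Z)%Z%:~R.
  exact: intr_int.
have {}hz : r = z%:~R / N.+1%:R.
  by rewrite -hz -[X in X / _]mulr_natr mulfK // pnatr_eq0.
rewrite hz {1}(divz_eq z N.+1%:Z) -[X in _ - X]mulr_natr -[`|_|%N%:R]/(`|_|%N%:Z%:~R) gez0_abs ?modz_ge0 //.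
rewrite intrD mulrDl intrM mulfK ?pnatr_eq0 // [X in _ + X - _]mulrC addrK //.
Qed.
End Torsion.

(** * Subgroups, and maps additive on a subgroup only *)

Definition subgroup (V : zmodType) (H : set V) :=
  H 0 /\ forall x y, H x -> H y -> H (x - y).

Section Subgroup.
Variables (V : zmodType) (H : set V).
Hypothesis sH : subgroup H.

Lemma subgroupN x : H x -> H (- x).
Proof. by move=> Hx; rewrite -sub0r; apply sH => //; apply sH. Qed.

Lemma subgroupD x y : H x -> H y -> H (x + y).
Proof. by move=> Hx Hy; rewrite -[y]opprK; apply sH => //; apply: subgroupN. Qed.

Lemma subgroupMn x n : H x -> H (x *+ n).
Proof.
move=> Hx; elim: n => [|n IH]; first by rewrite mulr0n; apply sH.
by rewrite mulrS; apply: subgroupD.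
Qed.

Lemma subgroupMz x (z : int) : H x -> H (x *~ z).
Proof.
move=> Hx; case: z => n; first by rewrite -pmulrn; apply: subgroupMn.
by rewrite NegzE mulrNz -pmulrn; apply: subgroupN; apply: subgroupMn.
Qed.

Lemma subgroup_sum (I : Type) (r : seq I) (P : pred I) (F : I -> V) :
  (forall i, P i -> H (F i)) -> H (\sum_(i <- r | P i) F i).
Proof.
move=> hF; elim/big_ind: _ => //; first by apply sH.
exact: subgroupD.
Qed.
End Subgroup.

(** Additivity is asked on [H] alone because the maps to be extended are additive only there: [pint]
    on continuous cochains, [coef_pair] on coefficient functions of chains. *)
Definition on_zmod_morphism (V W : zmodType) (H : set V) (f : V -> W) :=
  forall x y, H x -> H y -> f (x - y) = f x - f y.

Section OnMorphism.
Variables (V W : zmodType) (H : set V) (f : V -> W).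
Hypotheses (sH : subgroup H) (fH : on_zmod_morphism H f).

Lemma on0 : f 0 = 0.
Proof. by rewrite -(subrr 0) fH ?subrr //; apply sH. Qed.

Lemma onN x : H x -> f (- x) = - f x.
Proof. by move=> Hx; rewrite -sub0r fH ?on0 ?sub0r //; apply sH. Qed.

Lemma onD x y : H x -> H y -> f (x + y) = f x + f y.
Proof.
by move=> Hx Hy; rewrite -{1}[y]opprK fH ?onN ?opprK //; apply: subgroupN.
Qed.

Lemma onMn x n : H x -> f (x *+ n) = f x *+ n.
Proof.
move=> Hx; elim: n => [|n IH]; first by rewrite !mulr0n on0.
by rewrite !mulrS onD ?IH //; apply: subgroupMn.
Qed.

Lemma on_sum (I : Type) (r : seq I) (F : I -> V) :
  (forall i, H (F i)) -> f (\sum_(i <- r) F i) = \sum_(i <- r) f (F i).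
Proof.
move=> hF; elim: r => [|i r IH]; first by rewrite !big_nil on0.
by rewrite !big_cons onD ?IH //; apply: subgroup_sum.
Qed.
End OnMorphism.

Lemma to_additive (V W : zmodType) (f : V -> W) :
  (forall x y, f (x - y) = f x - f y) -> exists F : {additive V -> W}, f = F.
Proof.
move=> fB; pose F : {additive V -> W} :=
  HB.pack f (GRing.isZmodMorphism.Build V W f fB).
by exists F.
Qed.

Definition is_graph (V : zmodType) (R : set (V * QZ)) :=
  subgroup R /\ forall t, R (0, t) -> t = 0.

(** * Extension of characters *)

Lemma pairMz (U V : zmodType) (x : U) (y : V) (z : int) :
  (x, y) *~ z = (x *~ z, y *~ z).
Proof.
rewrite [LHS]surjective_pairing; congr pair; first exact: (raddfMz fst).
exact: (raddfMz snd).
Qed.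

Section GraphStep.
Variables (V : zmodType) (R : set (V * QZ)) (x : V).
Hypothesis gR : is_graph R.

(* The value at [x] must be an [n]-th root of the value at the first multiple
   [n x] in the domain of [R]; it is free if there is no such multiple. *)
Lemma graph_value : exists t : QZ, forall (z : int) s, R (x *~ z, s) -> t *~ z = s.
Proof.
have sR := gR.1.
case: (pselect (exists n s, R (x *+ n.+1, s))) => [hn|hn]; last first.
  exists 0 => z s; case: z => [[|n]|n].
  - by rewrite mulr0z => /(gR.2 _) ->; rewrite mulr0z.
  - by move=> h; exfalso; apply: hn; exists n, s.
  - move=> h; exfalso; apply: hn; exists n, (- s).
    have -> : (x *+ n.+1, - s) = - (x *~ Negz n, s).
      by rewrite NegzE mulrNz; congr pair; rewrite /= opprK.
    exact: subgroupN.
have ex : exists n, `[< exists s, R (x *+ n.+1, s) >] by case: hn => n h; exists n; apply/asboolP.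
case: (ex_minnP ex) => n /asboolP[s hs] min.
have [t ht] := qz_div s n; exists t => z s' hs'.
pose k := (z %/ n.+1%:Z)%Z; pose r := `|(z %% n.+1%:Z)%Z|%N.
have zE : z = n.+1%:Z * k + r%:Z.
  by rewrite mulrC /r gez0_abs ?modz_ge0 // -divz_eq.
(* Subtracting [k] times the pair at the least multiple puts the remainder in the domain; minimality
   then forces [r = 0]. *)
have hr : R (x *+ r, s' - s *~ k).
  have := sR.2 _ _ hs' (subgroupMz sR k hs); congr R; congr pair.
    by rewrite pairMz /= zE mulrzDr mulrzA -pmulrn addrAC subrr add0r.
  by rewrite pairMz.
have hrn : (r < n.+1)%N by rewrite -ltz_nat gez0_abs ?modz_ge0 // ltz_mod.
case E : r hr hrn => [|r'] hr hrn.
  have /(gR.2 _)/eqP := hr; rewrite subr_eq0 => /eqP ->.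
  by rewrite zE E addr0 mulrzA -pmulrn ht.
have /min : `[< exists s, R (x *+ r'.+1, s) >] by apply/asboolP; eexists; exact: hr.
by move=> h; exfalso; move: h hrn; lia.
Qed.
End GraphStep.

Lemma graph_step (V : zmodType) (R : set (V * QZ)) (x : V) : is_graph R ->
  exists R', [/\ is_graph R', R `<=` R' & exists t, R' (x, t)].
Proof.
move=> gR; have [t ht] := graph_value x gR; have sR := gR.1.
exists [set p | exists v s (z : int), R (v, s) /\ p = (v + x *~ z, s + t *~ z)].
split; first split; first split.
- by exists 0, 0, 0; split; [exact: sR.1|rewrite !mulr0z !addr0].
- move=> _ _ [v [s [z [h ->]]]] [v' [s' [z' [h' ->]]]].
  exists (v - v'), (s - s'), (z - z'); split; first exact: (sR.2 _ _ h h').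
  by congr pair; rewrite /= mulrzBr opprD addrACA.
- move=> u [v [s [z [h [e1 e2]]]]].
  have hv : v = x *~ (- z) by rewrite mulrNz; apply/eqP; rewrite -addr_eq0 -e1.
  by rewrite e2; move: h; rewrite hv => /ht <-; rewrite mulrNz addNr.
- by move=> [v s] h; exists v, s, 0; rewrite !mulr0z !addr0.
- exists t, 0, 0, 1; split; first exact: sR.1.
  by rewrite !mulr1z !add0r.
Qed.

(* Divisibility of [Q/Z] makes it injective; extension problems are stated for
   graphs, so that well-definedness is the condition at [0] alone. *)
Lemma char_ext (V : zmodType) (R : set (V * QZ)) : is_graph R ->
  exists F : {additive V -> QZ}, forall v t, R (v, t) -> F v = t.
Proof.
(* Zorn runs over the sets to be added to [R], not over the graphs containing [R]: the empty chain
   has union [set0], which must be admissible. *)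
move=> gR; pose P (S : set (V * QZ)) := is_graph (R `|` S).
have chainP (F : set (set (V * QZ))) : F `<=` P -> total_on F subset ->
    P (\bigcup_(X in F) X).
  move=> FP Ftot; set U := \bigcup_(X in F) X.
  have common p p' : (R `|` U) p -> (R `|` U) p' ->
      exists S, [/\ P S, S `<=` U, (R `|` S) p & (R `|` S) p'].
    have P0 : P set0 by rewrite /P setU0.
    have sub S : F S -> S `<=` U by move=> FS y Sy; exists S.
    move=> [h|[S FS h]] [h'|[S' FS' h']].
    - by exists set0; split=> //; left.
    - by exists S'; split; [exact: FP|exact: sub|left|right].
    - by exists S; split; [exact: FP|exact: sub|right|left].
    - have [SS'|S'S] := Ftot _ _ FS FS'.
        by exists S'; split; [exact: FP|exact: sub|right; exact: SS'|right].
      by exists S; split; [exact: FP|exact: sub|right|right; exact: S'S].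
  split; first split.
  - by left; exact: gR.1.1.
  - move=> p p' hp hp'; have [S [PS SU h h']] := common _ _ hp hp'.
    by case: (PS.1.2 _ _ h h') => [?|/SU]; [left|right].
  - by move=> t ht; have [S [PS _ h _]] := common _ _ ht ht; exact: PS.2 h.
have [A [PA maxA]] := Zorn_bigcup chainP.
have total x : exists t, (R `|` A) (x, t).
  have [R' [gR' sub [t ht]]] := graph_step x PA.
  exists t; right; apply: contrapT => nA; apply: (maxA R').
    by split; [move=> p Ap; apply: sub; right|move=> /(_ _ ht)].
  by rewrite /P; suff -> : R `|` R' = R' by []; apply/setUidPr => p Rp; apply: sub; left.
have uniq x t t' : (R `|` A) (x, t) -> (R `|` A) (x, t') -> t = t'.
  move=> h h'; apply/eqP; rewrite -subr_eq0; apply/eqP; apply: PA.2.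
  by have := PA.1.2 _ _ h h'; rewrite -[(x, t) - _]/(x - x, t - t') subrr.
have [f hf] := choice total.
have fB x y : f (x - y) = f x - f y.
  apply: (uniq (x - y)); first exact: hf.
  exact: PA.1.2 _ _ (hf x) (hf y).
have [F eF] := to_additive fB; exists F => v t h.
by rewrite -eF; apply: (uniq v) => //; left.
Qed.

Lemma extend_on (V : zmodType) (Z : set V) (f : V -> QZ) :
  subgroup Z -> on_zmod_morphism Z f ->
  exists F : {additive V -> QZ}, forall x, Z x -> F x = f x.
Proof.
move=> sZ fZ.
have gR : is_graph [set p : V * QZ | Z p.1 /\ p.2 = f p.1].
  split; last by move=> t [_ /= ->]; exact: (on0 sZ fZ).
  split; first by split => /=; [exact: sZ.1|rewrite (on0 sZ fZ)].
  move=> [x s] [y t] [/= Zx ->] [/= Zy ->]; split; first exact: sZ.2.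
  by rewrite /= fZ.
by have [F hF] := char_ext gR; exists F => x Zx; apply: hF.
Qed.

(** Let [n.+1] be the least positive multiplier sending [x] into [H]. The integers [z] with [x *~ z]
    in [H] are its multiples, so [H] can go to 0 and [x] to [tau n], of exact order [n.+1]; this is
    nonzero, as [n = 0] would put [x] in [H]. *)
Lemma char_sep (V : zmodType) (H : set V) (x : V) (N : nat) :
  subgroup H -> ~ H x -> H (x *+ N.+1) ->
  exists F : {additive V -> QZ}, (forall y, H y -> F y = 0) /\ F x <> 0.
Proof.
move=> sH nHx HN.
have ex : exists n, `[< H (x *+ n.+1) >] by exists N; apply/asboolP.
case: (ex_minnP ex) => n /asboolP Hn min.
have divz (z : int) : H (x *~ z) -> tau n *~ z = 0.
  move=> Hz; pose r := `|(z %% n.+1%:Z)%Z|%N.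
  have zE : z = n.+1%:Z * (z %/ n.+1%:Z)%Z + r%:Z.
    by rewrite mulrC /r gez0_abs ?modz_ge0 // -divz_eq.
  have Hr : H (x *+ r).
    have -> : x *+ r = x *~ z - x *+ n.+1 *~ (z %/ n.+1%:Z)%Z.
      by rewrite {1}zE mulrzDr mulrzA -!pmulrn addrAC subrr add0r.
    by apply sH => //; apply: subgroupMz.
  have hrn : (r < n.+1)%N by rewrite -ltz_nat gez0_abs ?modz_ge0 // ltz_mod.
  have r0 : r = 0%N.
    case E : r Hr hrn => [//|r'] Hr hrn.
    have /min : `[< H (x *+ r'.+1) >] by apply/asboolP.
    by move=> h; exfalso; move: h hrn; lia.
  by rewrite zE r0 addr0 mulrzA -pmulrn tau_tors mul0rz.
have gR : is_graph [set p : V * QZ | exists (h : V) (z : int),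
    H h /\ p = (h + x *~ z, tau n *~ z)].
  split; first split.
  - by exists 0, 0; split; [exact: sH.1|rewrite !mulr0z addr0].
  - move=> _ _ [h [z [Hh ->]]] [h' [z' [Hh' ->]]].
    exists (h - h'), (z - z'); split; first exact: sH.2.
    by congr pair; rewrite /= mulrzBr // opprD addrACA.
  - move=> t [h [z [Hh [e1 ->]]]]; apply: divz.
    suff -> : x *~ z = - h by apply: subgroupN.
    by apply/eqP; rewrite -addr_eq0 addrC -e1.
have [F hF] := char_ext gR; exists F; split.
  by move=> y Hy; apply: hF; exists y, 0; split => //; rewrite !mulr0z addr0.
have -> : F x = tau n.
  by apply: hF; exists 0, 1; split; [exact: sH.1|rewrite !mulr1z add0r].
move=> t0; have : (n.+1 %| 1)%N by apply: tau_eq0; rewrite mulr1n.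
rewrite dvdn1 => /eqP [n0]; apply: nHx.
by move: Hn; rewrite n0 mulr1n.
Qed.

(** On [Z] the map [g] factors through the tuple of the [f i], and extends to a character of the
    group of all tuples. On the torsion of one coordinate, a cyclic group generated by [tau N], such
    a character is multiplication by an integer. *)
Lemma annihilator (V : zmodType) (Z : set V) (N : nat) (I : finType)
    (f : I -> V -> QZ) (g : V -> QZ) :
  subgroup Z -> (forall i, on_zmod_morphism Z (f i)) -> on_zmod_morphism Z g ->
  (forall i x, Z x -> f i x *+ N.+1 = 0) ->
  (forall x, Z x -> (forall i, f i x = 0) -> g x = 0) ->
  exists c : {ffun I -> 'I_N.+1}, forall x, Z x -> g x = \sum_i f i x *+ c i.
Proof.
move=> sZ fZ gZ fN fg.
have gR : is_graph [set p : {ffun I -> QZ} * QZ | exists x,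
    Z x /\ p = ([ffun i => f i x], g x)].
  split; first split.
  - exists 0; split; [exact: sZ.1|congr pair; last by rewrite (on0 sZ gZ)].
    by apply/ffunP => i; rewrite !ffunE (on0 sZ (fZ i)).
  - move=> _ _ [x [Zx ->]] [y [Zy ->]]; exists (x - y); split; first exact: sZ.2.
    congr pair; last by rewrite gZ.
    by apply/ffunP => i; rewrite !ffunE fZ.
  - move=> t [x [Zx [e ->]]]; apply: fg => // i.
    by move/ffunP: e => /(_ i); rewrite !ffunE.
have [F hF] := char_ext gR.
pose d i (t : QZ) : {ffun I -> QZ} := [ffun j => if j == i then t else 0].
have dMn i t n : d i (t *+ n) = d i t *+ n.
  apply/ffunP => j; rewrite ffunMnE !ffunE.
  by case: ifP => // _; rewrite mul0rn.
have hc i : exists c : 'I_N.+1, F (d i (tau N)) = tau N *+ c.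
  apply: tors_tau; rewrite -raddfMn -dMn tau_tors.
  rewrite (_ : d i 0 = 0) ?raddf0 //.
  by apply/ffunP => j; rewrite !ffunE if_same.
have [c cE] := choice hc; exists [ffun i => c i] => x Zx.
have <- : F [ffun i => f i x] = g x by apply: hF; exists x.
have -> : [ffun i => f i x] = \sum_i d i (f i x).
  apply/ffunP => j; rewrite sum_ffunE ffunE (bigD1 j) //= big1 => [|i /negPf ij].
    by rewrite ffunE eqxx addr0.
  by rewrite ffunE eq_sym ij.
rewrite raddf_sum; apply: eq_bigr => i _.
have [k ->] := tors_tau (fN i x Zx).
by rewrite dMn raddfMn /= cE ffunE -!mulrnA mulnC.
Qed.

(** * Pairings with values in Q/Z *)

(* A pairing of the groups [ZX / BX] and [ZY / BY], both killed by [N + 1];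
   the quotients are never formed. *)
Record is_pairing (X Y : zmodType) (e : X -> Y -> QZ)
    (ZX BX : set X) (ZY BY : set Y) (N : nat) : Prop := IsPairing {
  pr_sZX : subgroup ZX; pr_sBX : subgroup BX;
  pr_sZY : subgroup ZY; pr_sBY : subgroup BY;
  pr_BX : BX `<=` ZX; pr_BY : BY `<=` ZY;
  pr_l : forall y, ZY y -> on_zmod_morphism ZX (e^~ y);
  pr_r : forall x, ZX x -> on_zmod_morphism ZY (e x);
  pr_l0 : forall x y, BX x -> ZY y -> e x y = 0;
  pr_r0 : forall x y, ZX x -> BY y -> e x y = 0;
  pr_lN : forall x, ZX x -> BX (x *+ N.+1);
  pr_rN : forall y, ZY y -> BY (y *+ N.+1) }.

Lemma pairing_flip X Y e ZX BX ZY BY N :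
  @is_pairing X Y e ZX BX ZY BY N ->
  is_pairing (fun y x => e x y) ZY BY ZX BX N.
Proof. by case=> *; split=> // *; auto. Qed.

Section Properties.
Variables (X Y : zmodType) (e : X -> Y -> QZ).
Variables (ZX BX : set X) (ZY BY : set Y).

Definition adj_inj := forall x, ZX x -> (forall y, ZY y -> e x y = 0) -> BX x.
(** Characters of [ZY / BY] are represented by characters of the ambient group [Y] that kill [BY];
    by [extend_on] none is lost. The same convention serves in [finite_dual]. *)
Definition adj_surj := forall phi : {additive Y -> QZ},
  (forall y, BY y -> phi y = 0) ->
  exists x, ZX x /\ forall y, ZY y -> e x y = phi y.
Definition finite_dual := exists (I : finType) (L : I -> {additive X -> QZ}),
  (forall i x, BX x -> L i x = 0) /\
  forall phi : {additive X -> QZ}, (forall x, BX x -> phi x = 0) ->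
    exists i, forall x, ZX x -> phi x = L i x.
End Properties.

Section Pairing.
Variables (X Y : zmodType) (e : X -> Y -> QZ).
Variables (ZX BX : set X) (ZY BY : set Y) (N : nat).
Hypothesis pr : is_pairing e ZX BX ZY BY N.

Let flip_e := fun y x => e x y.

Lemma pairing_char y : ZY y -> exists phi : {additive X -> QZ},
  (forall x, BX x -> phi x = 0) /\ (forall x, ZX x -> phi x = e x y).
Proof.
move=> Zy; have [F hF] := extend_on (pr_sZX pr) (pr_l pr Zy).
exists F; split=> // x Bx; rewrite hF; last exact: (pr_BX pr).
exact: (pr_l0 pr).
Qed.

Lemma pairing_tors x y : ZX x -> ZY y -> e x y *+ N.+1 = 0.
Proof.
move=> Zx Zy; rewrite -(onMn (pr_sZX pr) (pr_l pr Zy)) //.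
exact/(pr_l0 pr)/Zy/(pr_lN pr).
Qed.

Lemma surj_inj : adj_surj e ZX ZY BY -> adj_inj flip_e ZY BY ZX.
Proof.
move=> surj y Zy hy; apply: contrapT => nBy.
have [F [FB Fy]] := char_sep (pr_sBY pr) nBy (pr_rN pr Zy).
have [x [Zx ex]] := surj F FB.
by apply: Fy; rewrite -ex //; exact: hy.
Qed.

Lemma pairing_combination (I : finType) (x : I -> X) (c : I -> nat) y :
  (forall i, ZX (x i)) -> ZY y ->
  e (\sum_i x i *+ c i) y = \sum_i e (x i) y *+ c i.
Proof.
move=> Zx Zy; rewrite (on_sum (pr_sZX pr) (pr_l pr Zy)).
  by apply: eq_bigr => i _; rewrite (onMn (pr_sZX pr) (pr_l pr Zy)).
by move=> i; apply: subgroupMn => //; exact: (pr_sZX pr).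
Qed.

(** A character killing [BY] kills the common kernel of the [e (x i)], hence is a combination of
    them by [annihilator]; the same combination of the [x i] represents it. *)
Lemma separating_surj (I : finType) (x : I -> X) : (forall i, ZX (x i)) ->
  (forall y, ZY y -> (forall i, e (x i) y = 0) -> BY y) -> adj_surj e ZX ZY BY.
Proof.
move=> Zx sep phi phiB.
have [||||c hc] := @annihilator Y ZY N I (fun i => e (x i)) phi (pr_sZY pr).
- by move=> i; exact: (pr_r pr).
- by move=> y y' _ _; rewrite raddfB.
- by move=> i y Zy; exact: pairing_tors.
- by move=> y Zy hy; apply: phiB; exact: sep.
exists (\sum_i x i *+ c i); split.
  apply: (subgroup_sum (pr_sZX pr)) => i _.
  exact: (subgroupMn (pr_sZX pr)).
by move=> y Zy; rewrite pairing_combination // hc.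
Qed.

(** For each listed character [L i], choose [x i] in [ZX] where it is nonzero, if there is one. A
    [y] orthogonal to all [x i] induces some [L i]; this vanishes at [x i], hence on all of [ZX],
    and injectivity puts [y] in [BY]. *)
Lemma finite_surj_l : adj_inj flip_e ZY BY ZX -> finite_dual ZX BX ->
  adj_surj e ZX ZY BY.
Proof.
move=> inj [I [L [LB hL]]].
have hx i : exists x, ZX x /\ ((exists x', ZX x' /\ L i x' <> 0) -> L i x <> 0).
  case: (pselect (exists x', ZX x' /\ L i x' <> 0)) => [[x [Zx hx]]|h].
    by exists x.
  by exists 0; split=> //; apply (pr_sZX pr).
have [x hx'] := choice hx.
apply: (@separating_surj _ x) => [i|y Zy h]; first by case: (hx' i).
apply: inj => // x' Zx'; rewrite /flip_e.
have [phi [phiB phiE]] := pairing_char Zy.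
have [i hi] := hL _ phiB.
apply: contrapT => ne; have [Zx hn] := hx' i.
apply: hn; last by rewrite -hi // phiE.
by exists x'; split=> //; rewrite -hi // phiE.
Qed.

(** Each listed character that some element of [ZY] induces is realised by a chosen [y i]. Every
    element of [ZY] then induces the same character as one of the [y i], so these already separate
    [ZX] modulo [BX]. *)
Lemma finite_surj_r : adj_inj e ZX BX ZY -> finite_dual ZX BX ->
  adj_surj flip_e ZY ZX BX.
Proof.
move=> inj [I [L [LB hL]]].
have hy i : exists y, ZY y /\
    ((exists y', ZY y' /\ forall x, ZX x -> e x y' = L i x) ->
     forall x, ZX x -> e x y = L i x).
  case: (pselect (exists y', ZY y' /\ forall x, ZX x -> e x y' = L i x)).
    by move=> [y [Zy hy]]; exists y.
  by move=> h; exists 0; split=> //; apply (pr_sZY pr).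
have [y hy'] := choice hy.
have Zy i : ZY (y i) by case: (hy' i).
have sep x : ZX x -> (forall i, e x (y i) = 0) -> BX x.
  move=> Zx h; apply: inj => // y' Zy'.
  have [phi [phiB phiE]] := pairing_char Zy'.
  have [i hi] := hL _ phiB.
  have <- : e x (y i) = e x y'.
    rewrite (hy' i).2 // -?hi ?phiE //.
    by exists y'; split=> // x' Zx'; rewrite -hi // phiE.
  exact: h.
move=> phi phiB.
have [||||c hc] := @annihilator X ZX N I (fun i => e^~ (y i)) phi (pr_sZX pr).
- by move=> i; exact: (pr_l pr).
- by move=> x x' _ _; rewrite raddfB.
- by move=> i x Zx; exact: pairing_tors.
- by move=> x Zx hx; apply: phiB; exact: sep.
exists (\sum_i y i *+ c i); split.
  apply: (subgroup_sum (pr_sZY pr)) => i _.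
  exact: (subgroupMn (pr_sZY pr)).
move=> x Zx; rewrite /flip_e hc // (on_sum (pr_sZY pr) (pr_r pr Zx)).
  by apply: eq_bigr => i _; rewrite (onMn (pr_sZY pr) (pr_r pr Zx)).
by move=> i; apply: (subgroupMn (pr_sZY pr)).
Qed.

(** * Biorthogonal systems, and finiteness from two surjective adjoints *)

Definition orth_to (s : seq (X * Y)) (p : X * Y) :=
  [/\ ZX p.1, ZY p.2, e p.1 p.2 <> 0 &
      forall p', p' \in s -> e p.1 p'.2 = 0 /\ e p'.1 p.2 = 0].

(* If no pair extends a finite biorthogonal system, the characters killing its
   left half are combinations of its right half; hence a character is determined
   up to finitely many choices by its values on the left half. *)
Lemma orth_step (s : seq (X * Y)) :
  adj_surj flip_e ZY ZX BX -> ~ finite_dual ZX BX ->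
  (forall p, p \in s -> ZX p.1 /\ ZY p.2) -> exists p, orth_to s p.
Proof.
move=> surj nfin Zs; apply: contrapT => nex; apply: nfin.
pose I := 'I_(size s); pose a (i : I) := (nth (0, 0) s i).1.
pose b (i : I) := (nth (0, 0) s i).2.
have Za i : ZX (a i) by apply Zs; rewrite mem_nth.
have Zb i : ZY (b i) by apply Zs; rewrite mem_nth.
(* As no pair extends the system, the pairing vanishes between the orthogonal of the [b i] and that
   of the [a i]. *)
have perp x y : ZX x -> ZY y -> (forall i, e x (b i) = 0) ->
    (forall i, e (a i) y = 0) -> e x y = 0.
  move=> Zx Zy hx hy; apply: contrapT => ne; apply: nex; exists (x, y); split=> //.
  move=> p ps; have ip : (index p s < size s)%N by rewrite index_mem.
  have := hx (Ordinal ip); have := hy (Ordinal ip).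
  by rewrite /a /b /= nth_index.
(* One character is fixed for each vector of values on the [a i] that occurs at all; the zero
   character is the default for the others. *)
have hpsi (v : {ffun I -> 'I_N.+1}) : exists psi : {additive X -> QZ},
    (forall x, BX x -> psi x = 0) /\
    ((exists psi' : {additive X -> QZ}, (forall x, BX x -> psi' x = 0) /\
       forall i, psi' (a i) = tau N *+ v i) ->
     forall i, psi (a i) = tau N *+ v i).
  case: (pselect (exists psi' : {additive X -> QZ}, (forall x, BX x -> psi' x = 0) /\
     forall i, psi' (a i) = tau N *+ v i)) => [[psi [h1 h2]]|h]; first by exists psi.
  by exists \0; split.
have [psi psiP] := choice hpsi.
have hchi i : exists chi : {additive X -> QZ},
    (forall x, BX x -> chi x = 0) /\ (forall x, ZX x -> chi x = e x (b i)).
  exact: pairing_char.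
have [chi chiP] := choice hchi.
have hL (vc : {ffun I -> 'I_N.+1} * {ffun I -> 'I_N.+1}) :
    exists L : {additive X -> QZ}, forall x,
      L x = psi vc.1 x + \sum_i chi i x *+ vc.2 i.
  have [x y|L eL] := @to_additive _ _ (fun x => psi vc.1 x + \sum_i chi i x *+ vc.2 i).
    rewrite raddfB opprD addrACA -sumrB; congr (_ + _).
    by apply: eq_bigr => i _; rewrite raddfB mulrnBl.
  by exists L => x; rewrite -eL.
have [L LE] := choice hL.
exists ({ffun I -> 'I_N.+1} * {ffun I -> 'I_N.+1})%type, L; split.
  move=> [v c] x Bx; rewrite LE (psiP v).1 // add0r.
  by apply: big1 => i _; rewrite (chiP i).1 // mul0rn.
move=> phi phiB.
have hv i : exists k : 'I_N.+1, phi (a i) = tau N *+ k.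
  by apply: tors_tau; rewrite -raddfMn; apply: phiB; exact: (pr_lN pr).
have [k kE] := choice hv.
pose v := [ffun i => k i].
have vE i : phi (a i) = tau N *+ v i by rewrite ffunE.
have psiv : forall i, psi v (a i) = tau N *+ v i.
  by apply: (psiP v).2; exists phi.
(* The difference kills every [a i], so the [y] inducing it is orthogonal to them. By [perp] it also
   kills the orthogonal of the [b i], and [annihilator] writes it in terms of the [b i]. *)
have [|y [Zy hy]] := surj (phi \- psi v).
  by move=> x Bx /=; rewrite phiB // (psiP v).1 // subr0.
have [||||c hc] := @annihilator X ZX N I (fun i => e^~ (b i)) (phi \- psi v) (pr_sZX pr).
- by move=> i; exact: (pr_l pr).
- by move=> x x' _ _; rewrite raddfB.
- by move=> i x Zx; exact: pairing_tors.
- move=> x Zx hx; rewrite -hy //; apply: perp => // i.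
  by have := hy (a i) (Za i); rewrite /flip_e /= vE psiv subrr.
exists (v, c) => x Zx; rewrite LE /=.
have /= := hc x Zx; move/eqP; rewrite subr_eq addrC => /eqP ->.
by congr (_ + _); apply: eq_bigr => i _; rewrite (chiP i).2.
Qed.

Lemma surj_finite : adj_surj e ZX ZY BY -> adj_surj flip_e ZY ZX BX ->
  finite_dual ZX BX.
Proof.
move=> surjX surjY; apply: contrapT => nfin.
have hstep s : exists p, (forall q, q \in s -> ZX q.1 /\ ZY q.2) -> orth_to s p.
  case: (pselect (forall q, q \in s -> ZX q.1 /\ ZY q.2)) => [h|h].
    by have [p hp] := orth_step surjY nfin h; exists p.
  by exists (0, 0).
have [p pP] := choice hstep.
(* The first [n] pairs of the system, newest first; orthogonality of two pairs is read off from the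
   later one. *)
pose S n := iter n (fun s => p s :: s) [::].
have SP n : forall q, q \in S n -> ZX q.1 /\ ZY q.2.
  elim: n => [//|n IH] q; rewrite inE => /orP[/eqP ->|/IH //].
  by have [] := pP _ IH.
have memS m n : (m < n)%N -> p (S m) \in S n.
  elim: n => [//|n IH]; rewrite ltnS leq_eqVlt inE => /orP[/eqP ->|/IH ->].
    by rewrite eqxx.
  by rewrite orbT.
pose a n := (p (S n)).1; pose b n := (p (S n)).2.
have Za n : ZX (a n) by have [] := pP _ (SP n).
have Zb n : ZY (b n) by have [] := pP _ (SP n).
have diag n : e (a n) (b n) <> 0 by have [] := pP _ (SP n).
have orth m n : m <> n -> e (a m) (b n) = 0.
  move=> /eqP; rewrite neq_ltn => /orP[/memS|/memS] h.
    by have [_ _ _ /(_ _ h)[]] := pP _ (SP n).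
  by have [_ _ _ /(_ _ h)[]] := pP _ (SP m).
(* The formal sum [sum_i b_i], evaluated on the [x] for which it is finite. *)
have [binf [Zbinf hbinf]] : exists y, ZY y /\
    forall x n, ZX x -> (forall i, (n <= i)%N -> e x (b i) = 0) ->
      e x y = \sum_(i < n) e x (b i).
  have sumE x m n : (forall i, (m <= i)%N -> e x (b i) = 0) -> (m <= n)%N ->
      \sum_(i < n) e x (b i) = \sum_(i < m) e x (b i).
    move=> h mn; rewrite -!(big_mkord xpredT (fun i => e x (b i))).
    rewrite (big_cat_nat (n := m)) //=.
    have -> : \sum_(m <= i < n) e x (b i) = 0; last by rewrite addr0.
    by rewrite big_nat_cond big1 // => i /andP[/andP[mi _] _]; exact: h.
  have gR : is_graph [set q : X * QZ | exists n, [/\ ZX q.1,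
      forall i, (n <= i)%N -> e q.1 (b i) = 0 &
      q.2 = \sum_(i < n) e q.1 (b i)]].
    split; first split.
    - exists 0%N; split=> /=; [exact: (pr_sZX pr).1| |by rewrite big_ord0].
      by move=> i _; exact: (on0 (pr_sZX pr) (pr_l pr (Zb i))).
    - move=> [x s] [y t] [m [/= Zx hx ->]] [n [/= Zy hy ->]].
      exists (maxn m n); split=> /=; first exact: (pr_sZX pr).2.
        move=> i; rewrite geq_max => /andP[mi ni].
        by rewrite (pr_l pr (Zb i)) // hx ?hy ?subr0.
      rewrite -(sumE x m (maxn m n)) ?leq_maxl // -(sumE y n (maxn m n)) ?leq_maxr //.
      by rewrite -sumrB; apply: eq_bigr => i _; rewrite (pr_l pr (Zb i)).
    - move=> t [n [_ _ /= ->]]; apply: big1 => i _.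
      exact: (on0 (pr_sZX pr) (pr_l pr (Zb i))).
  have [F hF] := char_ext gR.
  have [|y [Zy hy]] := surjY F.
    move=> x Bx; apply: hF; exists 0%N; rewrite big_ord0; split=> //=.
      exact: (pr_BX pr).
    by move=> i _; exact: (pr_l0 pr).
  exists y; split=> // x n Zx hx; rewrite -[e x y]/(flip_e y x) hy //.
  by apply: hF; exists n.
(* [binf] lies outside [W], since it pairs with every [a n] as [b n] does, but every [b n] lies
   inside. *)
pose W y := ZY y /\ exists n, forall i, (n <= i)%N -> e (a i) y = 0.
have sW : subgroup W.
  split; first split; first exact: (pr_sZY pr).1.
    by exists 0%N => i _; exact: (on0 (pr_sZY pr) (pr_r pr (Za i))).
  move=> y z [Zy [m hy]] [Zz [n hz]]; split; first exact: (pr_sZY pr).2.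
  exists (maxn m n) => i; rewrite geq_max => /andP[mi ni].
  by rewrite (pr_r pr (Za i)) // hy ?hz ?subr0.
have BW y : BY y -> W y.
  by move=> By; split; [exact: (pr_BY pr)|exists 0%N => i _; exact: (pr_r0 pr)].
have abinf n : e (a n) binf = e (a n) (b n).
  rewrite (hbinf _ n.+1) // => [|i ni]; last by apply: orth => E; rewrite E ltnn in ni.
  rewrite big_ord_recr /= big1 ?add0r // => i _; apply: orth => E.
  by have := ltn_ord i; rewrite -E ltnn.
have [||F [FW Fb]] := @char_sep Y W binf N sW.
- by move=> [_ [n /(_ n (leqnn n))]]; rewrite abinf; exact: diag.
- exact/BW/(pr_rN pr).
have [|x [Zx hx]] := surjX F; first by move=> y /BW; exact: FW.
(* [F] kills each [b i], which is in [W] with bound [i.+1]; hence so does [x], and the formal sum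
   can be evaluated with bound 0, as an empty sum. *)
apply: Fb; rewrite -hx // (hbinf _ 0%N) ?big_ord0 // => i _.
rewrite hx //; apply: FW; split=> //; exists i.+1 => j ij; apply: orth => E.
by rewrite E ltnn in ij.
Qed.
End Pairing.

(** * Abstract chains and cochains *)

Lemma asbool_eq (T : eqType) (x y : T) : `[< x = y >] = (x == y).
Proof. by apply/asboolP/eqP. Qed.

Section Chains.
Variables (G : profinite_group) (M : fin_gmodule G).
Local Notation "1g" := (pg_one G).
Local Notation act := (@gm_act G M).
Local Notation cochains := (seq G -> M -> rat).
Local Notation chain := (seq (seq G * M)).

Lemma cardM_gt0 : (0 < #|M|)%N.
Proof. by apply/card_gt0P; exists 0. Qed.

(** Translation by [m] permutes [M] and so preserves the sum of all its elements. *)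
Lemma cardM_tors (m : M) : m *+ #|M|.-1.+1 = 0.
Proof.
rewrite prednK ?cardM_gt0 //; apply: (addrI (\sum_(x : M) x)).
rewrite addr0 [RHS](reindex_inj (addIr m)) big_split /= sumr_const.
by congr (_ + _); rewrite cardE.
Qed.

Lemma qz_eqE (f f' : M -> rat) : qz_eq f f' <-> forall m, qz (f m) = qz (f' m).
Proof. by split=> h m; apply/qz_eqP; exact: h. Qed.

Lemma is_dualE (f : M -> rat) :
  is_dual f <-> forall m m', qz (f (m + m')) = qz (f m) + qz (f m').
Proof.
split=> h m m'.
  by have /qz_eq0 := h m m'; rewrite !raddfB /= -addrA -opprD => /eqP; rewrite subr_eq0 => /eqP.
by apply/qz_eq0; rewrite !raddfB /= h addrAC addrK subrr.
Qed.

Section Dual.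
Variables (f : M -> rat).
Hypothesis df : is_dual f.

Lemma dualD m m' : qz (f (m + m')) = qz (f m) + qz (f m').
Proof. exact: (is_dualE f).1. Qed.

Lemma dual0 : qz (f 0) = 0.
Proof. by apply: (addrI (qz (f 0))); rewrite -dualD !addr0. Qed.

Lemma dualN m : qz (f (- m)) = - qz (f m).
Proof. by apply/eqP; rewrite -addr_eq0 -dualD addNr dual0. Qed.

Lemma dual_sum (I : Type) (r : seq I) (P : pred I) (F : I -> M) :
  qz (f (\sum_(i <- r | P i) F i)) = \sum_(i <- r | P i) qz (f (F i)).
Proof. exact: (big_morph (fun m => qz (f m)) dualD dual0). Qed.

Lemma dual_signm k m : qz ((-1) ^+ k * f m) = qz (f (signm k m)).
Proof.
rewrite -signr_odd /signm; case: (odd k); last by rewrite mul1r.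
by rewrite mulN1r raddfN dualN.
Qed.
End Dual.

Lemma is_dualB f f' : is_dual f -> is_dual f' -> is_dual (fun m : M => f m - f' m).
Proof.
move=> df df'; apply/is_dualE => m m' /=.
by rewrite !raddfB /= (dualD df) (dualD df') opprD addrACA.
Qed.

Lemma cochainB q (c c' : cochains) : cochain q c -> cochain q c' -> cochain q (c - c').
Proof. by move=> h h' x sx; apply: is_dualB; [apply: h|apply: h']. Qed.

Lemma size_mergeg q i (x : seq G) : (i < q)%N -> size x = q.+1 -> size (mergeg i x) = q.
Proof.
move=> iq sx; rewrite /mergeg size_cat /= size_take size_drop sx ifT; lia.
Qed.

(** With signs and action moved into the argument of the cochain, the terms match those of [abound]
    and [pbound] one by one, and both adjunctions can be checked termwise. *)
Lemma qz_cobound q (c : cochains) x m : cochain q c -> size x = q.+1 ->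
  qz (cobound q c x m) = qz (c (behead x) (act (pg_inv (nth 1g x 0)) m))
    + \sum_(i < q) qz (c (mergeg i x) (signm i.+1 m))
    + qz (c (take q x) (signm q.+1 m)).
Proof.
move=> cc sx; rewrite /cobound !raddfD /= raddf_sum /= dual_signm; last first.
  by apply: cc; rewrite size_takel ?sx.
congr (_ + _ + _); apply: eq_bigr => i _.
by rewrite dual_signm //; apply: cc; exact: size_mergeg.
Qed.

Lemma cochainBE (c c' : cochains) x m : (c - c') x m = c x m - c' x m.
Proof. by []. Qed.

Lemma coboundB q (c c' : cochains) : cobound q (c - c') = cobound q c - cobound q c'.
Proof.
apply: funext => x; apply: funext => m; rewrite cochainBE /cobound /dual_act.
rewrite !cochainBE mulrBr [in RHS]opprD [RHS]addrACA [in RHS]opprD [X in _ = X + _]addrACA; congr (_ + _ + _).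
by rewrite -sumrB; apply: eq_bigr => i _; rewrite cochainBE mulrBr.
Qed.

Definition eval_chain (c : cochains) (s : chain) : QZ := \sum_(p <- s) qz (c p.1 p.2).

Lemma eval_chain_cat c s s' : eval_chain c (s ++ s') = eval_chain c s + eval_chain c s'.
Proof. exact: big_cat. Qed.

Lemma eval_chainB c c' s : eval_chain (c - c') s = eval_chain c s - eval_chain c' s.
Proof. by rewrite /eval_chain -sumrB; apply: eq_bigr => p _; rewrite -raddfB. Qed.

Lemma eval_chain_aneg q c s : cochain q c -> achain q s -> eval_chain c (aneg s) = - eval_chain c s.
Proof.
move=> cc sc; rewrite /eval_chain /aneg big_map -sumrN !big_seq; apply: eq_bigr => p ps /=.
by apply: dualN; apply: cc; apply: sc.
Qed.

Lemma acoef_cat (s s' : chain) : acoef (s ++ s') = acoef s + acoef s'.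
Proof. by apply/funext => y; rewrite /acoef big_cat. Qed.

Lemma acoef_aneg (s : chain) : acoef (aneg s) = - acoef s.
Proof. by apply/funext => y; rewrite /acoef big_map /= sumrN. Qed.

Lemma acoef_nil : acoef ([::] : chain) = 0.
Proof. by apply/funext => y; rewrite /acoef big_nil. Qed.

Lemma acoef1 (x y : seq G) (m : M) : acoef [:: (x, m)] y = if x == y then m else 0.
Proof. by rewrite /acoef big_mkcond big_seq1 /= asbool_eq. Qed.

Lemma azeroE (s : chain) : azero s <-> acoef s = 0.
Proof. by split=> [h|h y]; [apply/funext => y; exact: h|exact: (congr1 (fun f => f y) h)]. Qed.

Lemma achain_cat q (s s' : chain) : achain q s -> achain q s' -> achain q (s ++ s').
Proof. by move=> h h' p; rewrite mem_cat => /orP[/h|/h']. Qed.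

Lemma achain_aneg q (s : chain) : achain q s -> achain q (aneg s).
Proof. by move=> h _ /mapP[p /h sp ->]. Qed.

(** Entries with the same point of [G^q] are grouped; additivity of the cochain there modulo Z turns
    each group into its value at a coefficient of the chain. *)
Lemma eval_chain_coef0 q c s : cochain q c -> achain q s -> acoef s = 0 -> eval_chain c s = 0.
Proof.
move=> cc sc s0; pose u := undup (map fst s).
have uP p : p \in s -> p.1 \in u by move=> ps; rewrite mem_undup map_f.
transitivity (\sum_(p <- s) \sum_(x <- u | x == p.1) qz (c x p.2)).
  rewrite /eval_chain !big_seq; apply: eq_bigr => p ps.
  by rewrite -big_filter filter_pred1_uniq ?undup_uniq ?uP // big_seq1.
rewrite (exchange_big_dep xpredT) //= big_seq big1 // => x.
rewrite mem_undup => /mapP[p ps ->].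
rewrite -dual_sum; last by apply: cc; apply: sc.
have <- : acoef s p.1 = \sum_(i <- s | p.1 == i.1) i.2.
  by apply: eq_bigl => j; rewrite asbool_eq eq_sym.
by rewrite s0 dual0 //; apply: cc; apply: sc.
Qed.

Lemma eval_chain_coef q c s s' : cochain q c -> achain q s -> achain q s' ->
  acoef s = acoef s' -> eval_chain c s = eval_chain c s'.
Proof.
move=> cc sc sc' e; apply/eqP; rewrite -subr_eq0 -(eval_chain_aneg cc sc') -eval_chain_cat.
apply/eqP; apply: (eval_chain_coef0 cc); first by apply: achain_cat => //; exact: achain_aneg.
by rewrite acoef_cat acoef_aneg e subrr.
Qed.

Lemma achain_abound q (s : chain) : achain q.+1 s -> achain q (abound q s).
Proof.
move=> sc r /flattenP[l /mapP[p /sc sp ->]].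
rewrite inE mem_cat inE => /or3P[/eqP -> /=|/mapP[i]|/eqP -> /=].
- by rewrite size_behead sp.
- by rewrite mem_iota => /andP[_ iq] -> /=; apply: size_mergeg.
- by rewrite size_takel ?sp.
Qed.

Lemma eval_chain_cobound q c s : cochain q c -> achain q.+1 s ->
  eval_chain (cobound q c) s = eval_chain c (abound q s).
Proof.
move=> cc sc; rewrite /eval_chain /abound big_flatten big_map !big_seq.
apply: eq_bigr => p ps; have sp := sc p ps; rewrite qz_cobound // big_cons big_cat big_map big_seq1 /=.
by rewrite -addrA -(big_mkord xpredT (fun i => qz (c (mergeg i p.1) (signm i.+1 p.2)))) /index_iota subn0.
Qed.

Lemma abound_cat q (s s' : chain) : abound q (s ++ s') = abound q s ++ abound q s'.
Proof. by rewrite /abound map_cat flatten_cat. Qed.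

Lemma gm_actN g m : act g (- m) = - act g m.
Proof.
have a0 : act g 0 = 0 by apply: (addrI (act g 0)); rewrite -gm_actD !addr0.
by apply/eqP; rewrite -addr_eq0 -gm_actD addNr a0.
Qed.

Lemma signmN k (m : M) : signm k (- m) = - signm k m.
Proof. by rewrite /signm; case: ifP. Qed.

Lemma abound_aneg q (s : chain) : abound q (aneg s) = aneg (abound q s).
Proof.
rewrite /abound /aneg map_flatten -!map_comp; congr flatten; apply: eq_map => p /=.
rewrite gm_actN map_cat -map_comp signmN; congr (_ :: _ ++ _).
by apply: eq_map => i /=; rewrite signmN.
Qed.

Lemma abound_nil q : abound q ([::] : chain) = [::].
Proof. by []. Qed.

(** A character is determined on finite formal sums by its values on single terms, and these values,
    additive in [m], form a cochain in every degree at once. *)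
Lemma chain_char (phi : {additive (seq G -> M) -> QZ}) : exists c : cochains,
  (forall q, cochain q c) /\ forall s, eval_chain c s = phi (acoef s).
Proof.
exists (fun x m => repr (phi (acoef [:: (x, m)]))); split=> [q x _|s].
  apply/is_dualE => m m'; rewrite !qz_repr -raddfD; congr (phi _).
  apply/funext => y; transitivity (acoef [:: (x, m)] y + acoef [:: (x, m')] y) => //.
  by rewrite !acoef1; case: ifP => // _; rewrite addr0.
elim: s => [|p s IH]; first by rewrite acoef_nil raddf0 /eval_chain big_nil.
rewrite -cat1s eval_chain_cat acoef_cat raddfD IH; congr (_ + _).
by rewrite /eval_chain big_seq1 qz_repr; case: p.
Qed.

Lemma acycle_sub q (s s' : chain) : acycle q s -> acycle q s' -> acycle q (s ++ aneg s').
Proof.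
move=> [sc h] [sc' h']; split; first by apply: achain_cat => //; exact: achain_aneg.
case: q sc h sc' h' => // p sc /azeroE h sc' /azeroE h'; apply/azeroE.
by rewrite abound_cat abound_aneg acoef_cat acoef_aneg h h' subrr.
Qed.

Lemma acycle_nil q : acycle q ([::] : chain).
Proof. by split=> //; case: q => // p; apply/azeroE; rewrite abound_nil acoef_nil. Qed.

Lemma eval_chain_aboundary q c s : cochain q c -> cocycle q c -> achain q s ->
  aboundary q s -> eval_chain c s = 0.
Proof.
move=> cc zc sc [b [bc /azeroE]]; rewrite acoef_cat acoef_aneg => /eqP.
rewrite subr_eq0 => /eqP e; rewrite (eval_chain_coef cc sc (achain_abound bc) e).
rewrite -eval_chain_cobound // /eval_chain big_seq big1 // => p /bc sp.
by have /qz_eqE -> := zc _ sp; rewrite raddf0.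
Qed.

Lemma eval_chain_coboundary q c s : coboundary (@cochain G M) q c -> acycle q s ->
  eval_chain c s = 0.
Proof.
case: q => [h [sc _]|p [b [bc h]] [sc /azeroE s0]].
  rewrite /eval_chain big_seq big1 // => r /sc sr.
  by have /qz_eqE -> := h _ sr; rewrite raddf0.
transitivity (eval_chain (cobound p b) s).
  rewrite /eval_chain !big_seq; apply: eq_bigr => r /sc sr.
  by have /qz_eqE -> := h _ sr.
by rewrite eval_chain_cobound // (eval_chain_coef0 bc (achain_abound sc) s0).
Qed.

Lemma achain1 q (x : seq G) (m : M) : size x = q -> achain q [:: (x, m)].
Proof. by move=> sx p; rewrite inE => /eqP ->. Qed.

Lemma eval_chain1 c x m : eval_chain c [:: (x, m)] = qz (c x m).
Proof. by rewrite /eval_chain big_seq1. Qed.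

(** Since [c] kills cycles, sending the boundary of [b] to the value of [c] on [b] is well defined.
    An extension of this character is a cochain whose coboundary is [c] modulo Z. *)
Lemma orth_cycles_coboundary q c : cochain q c ->
  (forall s, acycle q s -> eval_chain c s = 0) -> coboundary (@cochain G M) q c.
Proof.
case: q => [|p] cc h.
  move=> x sx; apply/qz_eqE => m; rewrite raddf0 -eval_chain1; apply: h.
  by split=> //; exact: achain1.
have gR : is_graph [set r : (seq G -> M) * QZ | exists b, achain p.+1 b /\
    r = (acoef (abound p b), eval_chain c b)].
  split; first split.
  - by exists [::]; rewrite abound_nil acoef_nil /eval_chain big_nil.
  - move=> _ _ [b [bc ->]] [b' [bc' ->]]; exists (b ++ aneg b'); split.
      by apply: achain_cat => //; exact: achain_aneg.
    by rewrite abound_cat abound_aneg acoef_cat acoef_aneg eval_chain_cat (eval_chain_aneg cc bc').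
  - by move=> t [b [bc [e ->]]]; apply: h; split=> //; apply/azeroE.
have [F hF] := char_ext gR; have [d [dc dF]] := chain_char F.
exists d; split=> // x sx; apply/qz_eqE => m.
rewrite -!eval_chain1 eval_chain_cobound //; last exact: achain1.
by rewrite dF; symmetry; apply: hF; exists [:: (x, m)]; split=> //; exact: achain1.
Qed.

(** Lists of terms do not form a group; their coefficient functions do, and formal equality of lists
    becomes equality. *)
Definition cycle_coefs q : set (seq G -> M) :=
  [set y | exists s, acycle q s /\ acoef s = y].
Definition boundary_coefs q : set (seq G -> M) :=
  [set y | exists s, [/\ acycle q s, aboundary q s & acoef s = y]].

Lemma aboundary_sub q (s s' : chain) : aboundary q s -> aboundary q s' ->
  aboundary q (s ++ aneg s').
Proof.
move=> [b [bc /azeroE h]] [b' [bc' /azeroE h']]; exists (b ++ aneg b'); split.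
  by apply: achain_cat => //; exact: achain_aneg.
apply/azeroE; move: h h'; rewrite abound_cat abound_aneg !(acoef_cat, acoef_aneg).
move=> /eqP; rewrite subr_eq0 => /eqP -> /eqP; rewrite subr_eq0 => /eqP ->.
by rewrite subrr.
Qed.

Lemma subgroup_cycle_coefs q : subgroup (cycle_coefs q).
Proof.
split; first by exists [::]; split; [exact: acycle_nil|exact: acoef_nil].
move=> _ _ [s [h <-]] [s' [h' <-]]; exists (s ++ aneg s').
by split; [exact: acycle_sub|rewrite acoef_cat acoef_aneg].
Qed.

Lemma subgroup_boundary_coefs q : subgroup (boundary_coefs q).
Proof.
split.
  exists [::]; split; [exact: acycle_nil| |exact: acoef_nil].
  by exists [::]; split=> //; apply/azeroE; rewrite acoef_nil.
move=> _ _ [s [h b <-]] [s' [h' b' <-]]; exists (s ++ aneg s').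
by split; [exact: acycle_sub|exact: aboundary_sub|rewrite acoef_cat acoef_aneg].
Qed.

Lemma aboundary_coef q (s s' : chain) : acoef s = acoef s' -> aboundary q s ->
  aboundary q s'.
Proof.
move=> e [b [bc /azeroE h]]; exists b; split=> //; apply/azeroE.
by move: h; rewrite !acoef_cat e.
Qed.

(** The character is prescribed as [phi] on cycles and 0 on the boundaries of all chains. The two
    agree because [phi] kills boundaries, and the second prescription is the cocycle condition. *)
Lemma cycle_char q (phi : {additive (seq G -> M) -> QZ}) :
  (forall y, boundary_coefs q y -> phi y = 0) ->
  exists c : cochains, [/\ cochain q c, cocycle q c &
    forall s, acycle q s -> eval_chain c s = phi (acoef s)].
Proof.
move=> phiB.
have gR : is_graph [set r : (seq G -> M) * QZ | exists s b, [/\ acycle q s,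
    achain q.+1 b & r = (acoef s + acoef (abound q b), phi (acoef s))]].
  split; first split.
  - exists [::], [::]; split=> //; first exact: acycle_nil.
    by rewrite abound_nil acoef_nil raddf0 addr0.
  - move=> _ _ [s [b [sc bc ->]]] [s' [b' [sc' bc' ->]]].
    exists (s ++ aneg s'), (b ++ aneg b'); split; first exact: acycle_sub.
      by apply: achain_cat => //; exact: achain_aneg.
    rewrite abound_cat abound_aneg !acoef_cat !acoef_aneg raddfB.
    by congr pair; rewrite /= opprD addrACA.
  - move=> t [s [b [sc bc [e ->]]]]; apply: phiB; exists s; split=> //.
    exists (aneg b); split; first exact: achain_aneg.
    by apply/azeroE; rewrite abound_aneg acoef_cat !acoef_aneg opprK -e.
have [F hF] := char_ext gR; have [c [cc cF]] := chain_char F.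
exists c; split=> //.
  move=> x sx; apply/qz_eqE => m; rewrite raddf0 -eval_chain1 eval_chain_cobound //; last exact: achain1.
  rewrite cF; apply: hF; exists [::], [:: (x, m)]; split; [exact: acycle_nil|exact: achain1|].
  by rewrite acoef_nil raddf0 add0r.
move=> s sc; rewrite cF; apply: hF; exists s, [::]; split=> //.
by rewrite abound_nil acoef_nil addr0.
Qed.

End Chains.

(** * Clopen subsets of the powers of G *)

Section ProductTopology.
Variable G : profinite_group.
Local Notation "1g" := (pg_one G).

Lemma popenP q (A : set (seq G)) : popen q A <->
  forall x, size x = q -> A x -> exists U : nat -> set G,
    (forall i, (i < q)%N -> open (U i) /\ U i (nth 1g x i)) /\
    (forall y, size y = q -> (forall i, (i < q)%N -> U i (nth 1g y i)) -> A y).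
Proof.
split=> h x sx Ax; have [U] := h x sx Ax.
  by move=> [sU [hU hA]]; exists (nth setT U).
move=> [hU hA]; exists (mkseq U q); split; first by rewrite size_mkseq.
split=> [i iq|y sy hy]; first by rewrite nth_mkseq //; exact: hU.
by apply: hA => // i iq; have := hy i iq; rewrite nth_mkseq.
Qed.

Lemma popen_ext q (A B : set (seq G)) : popen q A ->
  (forall x, size x = q -> A x <-> B x) -> popen q B.
Proof.
move=> /popenP h e; apply/popenP => x sx /(e x sx).2 Ax.
have [U [hU hA]] := h x sx Ax; exists U; split=> // y sy hy.
exact/(e y sy).1/hA.
Qed.

Lemma popenT q : popen q (fun _ : seq G => True).
Proof. by apply/popenP => x sx _; exists (fun=> setT); split=> // i iq; split=> //; exact: openT. Qed.

Lemma popenI q (A B : set (seq G)) : popen q A -> popen q B ->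
  popen q (fun x => A x /\ B x).
Proof.
move=> /popenP hA /popenP hB; apply/popenP => x sx [Ax Bx].
have [U [hU UA]] := hA x sx Ax; have [V [hV VB]] := hB x sx Bx.
exists (fun i => U i `&` V i); split=> [i iq|y sy hy].
  have [oU Ux] := hU i iq; have [oV Vx] := hV i iq.
  by split; [exact: openI|split].
by split; [apply: UA => // i /hy[]|apply: VB => // i /hy[]].
Qed.

Lemma popen_seq (I : eqType) (r : seq I) q (A : I -> set (seq G)) :
  (forall i, i \in r -> popen q (A i)) ->
  popen q (fun x => forall i, i \in r -> A i x).
Proof.
elim: r => [|j r IH] h; first by apply: (popen_ext (@popenT q)) => x sx; split.
have := popenI (h j (mem_head _ _)) (IH (fun i ir => h i (mem_behead (s := j :: r) ir))).
move/popen_ext; apply=> x sx; split=> [[Ax hx] i|hx].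
  by rewrite inE => /orP[/eqP ->|/hx].
by split; [apply: hx; exact: mem_head|move=> i ir; apply: hx; exact: mem_behead].
Qed.

Lemma popen_local q (A : set (seq G)) :
  (forall x, size x = q -> A x -> exists B, [/\ popen q B, B x & forall y, size y = q -> B y -> A y]) ->
  popen q A.
Proof.
move=> h; apply/popenP => x sx Ax; have [B [/popenP oB Bx BA]] := h x sx Ax.
have [U [hU UB]] := oB x sx Bx; exists U; split=> // y sy hy.
exact/BA/UB.
Qed.

Lemma popen_coord q i (O : set G) : (i < q)%N -> open O ->
  popen q (fun x => O (nth 1g x i)).
Proof.
move=> iq oO; apply/popenP => x sx Ox.
exists (fun j => if j == i then O else setT); split=> [j jq|y sy /(_ i iq)].
  by case: eqP => [->|_]; split=> //; exact: openT.
by rewrite eqxx.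
Qed.

Lemma popen_mul q i (O : set G) : (i.+1 < q)%N -> open O ->
  popen q (fun x => O (pg_mul (nth 1g x i) (nth 1g x i.+1))).
Proof.
move=> iq oO; apply: popen_local => x sx Ox.
have : nbhs (nth 1g x i, nth 1g x i.+1) [set p : G * G | O (pg_mul p.1 p.2)].
  apply: (@pg_mul_cont G (nth 1g x i, nth 1g x i.+1)).
  exact: open_nbhs_nbhs.
case=> -[B C] /= [nB nC] sub.
have [B' [oB' B'x] sB] : exists2 B', open_nbhs (nth 1g x i) B' & B' `<=` B
  by move: nB; rewrite nbhsE.
have [C' [oC' C'x] sC] : exists2 C', open_nbhs (nth 1g x i.+1) C' & C' `<=` C
  by move: nC; rewrite nbhsE.
exists (fun y => B' (nth 1g y i) /\ C' (nth 1g y i.+1)); split=> //.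
  by apply: popenI; apply: popen_coord => //; exact: ltnW.
by move=> y sy [By Cy]; apply: (sub (_, _)); split; [exact: sB|exact: sC].
Qed.

(** Continuity from [G^q'] to [G^q] for the product topologies, tested on coordinates. *)
Definition pcont q' q (rho : seq G -> seq G) :=
  (forall x, size x = q' -> size (rho x) = q) /\
  forall i O, (i < q)%N -> open O -> popen q' (fun x => O (nth 1g (rho x) i)).

Lemma popen_preim q' q rho A : pcont q' q rho -> popen q A ->
  popen q' (fun x => A (rho x)).
Proof.
move=> [srho crho] /popenP oA; apply: popen_local => x sx Ax.
have [U [hU UA]] := oA _ (srho x sx) Ax.
exists (fun y => forall i, i \in iota 0 q -> U i (nth 1g (rho y) i)); split.
- apply: popen_seq => i; rewrite mem_iota => /andP[_ iq].
  by apply: crho => //; apply (hU i iq).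
- by move=> i; rewrite mem_iota => /andP[_ iq]; apply (hU i iq).
- move=> y sy hy; apply: UA; first exact: srho.
  by move=> i iq; apply: hy; rewrite mem_iota.
Qed.

Lemma pcont_behead q : pcont q.+1 q behead.
Proof.
split=> [x sx|i O iq oO]; first by rewrite size_behead sx.
apply: (popen_ext (popen_coord (q := q.+1) (i := i.+1) iq oO)) => x sx.
by rewrite nth_behead.
Qed.

Lemma pcont_take q : pcont q.+1 q (take q).
Proof.
split=> [x sx|i O iq oO]; first by rewrite size_takel ?sx.
apply: (popen_ext (popen_coord (q := q.+1) (i := i) (ltnW iq) oO)) => x sx.
by rewrite nth_take.
Qed.

Lemma nth_mergeg q i j (x : seq G) : (i < q)%N -> size x = q.+1 ->
  nth 1g (mergeg i x) j =
    if (j < i)%N then nth 1g x j else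
    if j == i then pg_mul (nth 1g x i) (nth 1g x i.+1) else nth 1g x j.+1.
Proof.
move=> iq sx; rewrite /mergeg nth_cat size_takel ?sx ?(ltnW (leqW iq)) //.
case: ltnP => ji; first by rewrite nth_take.
case: eqVneq => [->|ne]; first by rewrite subnn.
have [k ->] : exists k, j = (i + k.+1)%N by exists (j - i).-1; lia.
by rewrite addKn /= nth_drop; congr nth; lia.
Qed.

Lemma pcont_mergeg q i : (i < q)%N -> pcont q.+1 q (mergeg i).
Proof.
move=> iq; split=> [x sx|j O jq oO]; first exact: size_mergeg.
have [ji|ij] := ltnP j i.
  apply: (popen_ext (popen_coord (q := q.+1) (i := j) (ltnW jq) oO)) => x sx.
  by rewrite (nth_mergeg _ iq sx) ji.
have [e|ne] := eqVneq j i.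
  apply: (popen_ext (popen_mul (q := q.+1) (i := i) iq oO)) => x sx.
  by rewrite (nth_mergeg _ iq sx) e ltnn eqxx.
apply: (popen_ext (popen_coord (q := q.+1) (i := j.+1) jq oO)) => x sx.
by rewrite (nth_mergeg _ iq sx) ltnNge ij (negPf ne).
Qed.

Definition locally_cst q (I : Type) (h : seq G -> I) :=
  forall x, size x = q -> popen q (fun y => h y = h x).

Lemma locally_cst_clopen q I (h : seq G -> I) (P : I -> Prop) : locally_cst q h ->
  pclopen q [set x | size x = q /\ P (h x)].
Proof.
move=> lh.
have op (Q : I -> Prop) : popen q (fun x => Q (h x)).
  apply: popen_local => x sx Qx; exists (fun y => h y = h x); split=> //.
  - exact: lh.
  - by move=> y _ ->.
split; first by move=> y [].
split; first by apply: (popen_ext (op P)) => x sx; split=> [|[]].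
by apply: (popen_ext (op (fun i => ~ P i))) => x sx /=; split=> [?|[_ H] ?]; [split=> // -[]|apply: H].
Qed.

Lemma clopen_locally_cst q (A : set (seq G)) : pclopen q A ->
  locally_cst q (fun x => `[< A x >]).
Proof.
move=> [_ [oA oNA]] x sx; case: (asboolP (A x)) => Ax.
  by apply: (popen_ext oA) => y sy; split=> [/asboolT|/asboolW].
apply: (popen_ext oNA) => y sy; split=> [[_ /asboolF]|e] //.
by split=> // /asboolT; rewrite e.
Qed.

Lemma locally_cst_pair q I J (h : seq G -> I) (k : seq G -> J) :
  locally_cst q h -> locally_cst q k -> locally_cst q (fun x => (h x, k x)).
Proof.
move=> lh lk x sx; apply: (popen_ext (popenI (lh x sx) (lk x sx))) => y sy.
by split=> [[-> ->]|[-> ->]].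
Qed.

Lemma locally_cst_comp q I J (h : seq G -> I) (r : I -> J) :
  locally_cst q h -> locally_cst q (fun x => r (h x)).
Proof.
move=> lh x sx; apply: popen_local => y sy e.
exists (fun z => h z = h y); split=> //; first exact: lh.
by move=> z _ ->.
Qed.

Lemma locally_cst_preim q' q rho I (h : seq G -> I) : pcont q' q rho ->
  locally_cst q h -> locally_cst q' (fun x => h (rho x)).
Proof.
by move=> cr lh x sx; exact: (popen_preim cr (lh (rho x) (cr.1 x sx))).
Qed.

Lemma locally_cst_ext q I (h k : seq G -> I) : (forall x, size x = q -> h x = k x) ->
  locally_cst q h -> locally_cst q k.
Proof.
move=> e lh x sx; apply: (popen_ext (lh x sx)) => y sy.
by rewrite (e x sx) (e y sy).
Qed.

Section Action.
Variable M : fin_gmodule G.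

(** The first entry of a sequence ranges over [G], but its action on [M] takes finitely many values;
    the first face in [pbound] is split along them. *)
Definition head_act (x : seq G) : {ffun M -> M} :=
  [ffun m => gm_act (pg_inv (nth 1g x 0)) m].

Lemma locally_cst_head_act q : locally_cst q.+1 head_act.
Proof.
move=> x sx.
have : popen q.+1 (fun y => forall m, m \in enum M ->
    gm_act (pg_inv (nth 1g y 0)) m = gm_act (pg_inv (nth 1g x 0)) m).
  apply: popen_seq => m _.
  have oO : open [set g : G | gm_act (pg_inv g) m = gm_act (pg_inv (nth 1g x 0)) m].
    have /continuousP oinv := @pg_inv_cont G.
    exact: (oinv _ (gm_act_cont m (gm_act (pg_inv (nth 1g x 0)) m))).
  exact: (popen_coord (q := q.+1) (i := 0) _ oO).
move/popen_ext; apply=> y sy; split=> [h|e m _].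
  by apply/ffunP => m; rewrite !ffunE h // mem_enum.
by have /ffunP/(_ m) := e; rewrite !ffunE.
Qed.
End Action.
End ProductTopology.

(** * Integration of continuous cochains *)

Section Measures.
Variables (G : profinite_group) (M : fin_gmodule G).
Local Notation "1g" := (pg_one G).
Local Notation act := (@gm_act G M).
Local Notation cochains := (seq G -> M -> rat).
Local Notation measure := (set (seq G) -> M).
Local Notation N := (#|M|.-1).
Local Notation code := {ffun M -> 'I_N.+1}.

Definition is_char (u : M -> QZ) := forall m m', u (m + m') = u m + u m'.

Section Char.
Variable u : M -> QZ.
Hypothesis cu : is_char u.

Lemma char0 : u 0 = 0.
Proof. by apply: (addrI (u 0)); rewrite -cu !addr0. Qed.

Lemma charN m : u (- m) = - u m.
Proof. by apply/eqP; rewrite -addr_eq0 -cu addNr char0. Qed.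

Lemma char_sum (I : Type) (r : seq I) (P : pred I) (F : I -> M) :
  u (\sum_(i <- r | P i) F i) = \sum_(i <- r | P i) u (F i).
Proof. exact: (big_morph u cu char0). Qed.

Lemma charMn m n : u (m *+ n) = u m *+ n.
Proof.
elim: n => [|n IH]; first by rewrite !mulr0n char0.
by rewrite !mulrS cu IH.
Qed.

Lemma char_tors m : u m *+ N.+1 = 0.
Proof. by rewrite -charMn cardM_tors char0. Qed.

Lemma char_signm k : is_char (fun m => u (signm k m)).
Proof.
move=> m m'; rewrite /signm; case: (odd k); last exact: cu.
by rewrite opprD cu.
Qed.
End Char.

Lemma is_char_dual (f : M -> rat) : is_dual f -> is_char (fun m => qz (f m)).
Proof. by move=> df m m'; exact: dualD. Qed.

Lemma is_char0 : is_char (fun=> 0).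
Proof. by move=> m m'; rewrite addr0. Qed.

Lemma char_separated (m m' : M) : (forall u, is_char u -> u m = u m') -> m = m'.
Proof.
move=> h; apply/eqP; rewrite -subr_eq0; apply/eqP; apply: contrapT => ne.
have s0 : subgroup [set x : M | x = 0].
  by split=> // x y -> ->; rewrite subrr.
have [|F [_ hF]] := char_sep (N := N) s0 ne; first exact: cardM_tors.
apply: hF; rewrite raddfB /=.
rewrite (h (fun m => F m)) ?subrr // => x y; exact: raddfD.
Qed.

(* The evaluations at the points of [M] are finitely many functionals whose
   common kernel is trivial. *)
Lemma biduality (g : (M -> QZ) -> QZ) :
  (forall u v, is_char u -> is_char v -> g (u - v) = g u - g v) ->
  exists m, forall u, is_char u -> g u = u m.
Proof.
move=> gB.
have sZ : subgroup [set u : M -> QZ | is_char u].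
  split; first by move=> m m'; rewrite addr0.
  move=> u v cu cv m m'.
  transitivity (u (m + m') - v (m + m')) => //.
  by rewrite cu cv opprD addrACA.
have [||||c hc] := @annihilator (M -> QZ) _ N M (fun m u => u m) g sZ.
- by move=> m u v _ _.
- by move=> u v cu cv; exact: gB.
- by move=> m u cu; exact: char_tors.
- move=> u cu u0; have -> : u = 0 by apply/funext.
  exact: (on0 sZ gB).
exists (\sum_m m *+ c m) => u cu; rewrite hc // (char_sum cu).
by apply: eq_bigr => m _; rewrite (charMn cu).
Qed.

(** The finite type [code] enumerates the dual of [M], as characters take values in the multiples of
    [tau N]. A code that gives no character decodes to 0, so that sums over all codes make sense. *)
Definition decode (k : code) : M -> QZ :=
  if `[< is_char (fun m => tau N *+ k m) >] then fun m => tau N *+ k m else fun=> 0.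

Lemma is_char_decode k : is_char (decode k).
Proof. by rewrite /decode; case: asboolP => // _; exact: is_char0. Qed.

Definition encode (u : M -> QZ) : code := xget [ffun=> ord0] [set k | decode k = u].

Lemma encodeK u : is_char u -> decode (encode u) = u.
Proof.
move=> cu; rewrite /encode; apply: (@xgetPex _ _ [set k | decode k = u]).
have [k hk] := choice (fun m => tors_tau (char_tors cu m)).
exists [ffun m => k m] => /=.
have e : (fun m => tau N *+ [ffun m => k m] m) = u.
  by apply/funext => m; rewrite ffunE -hk.
by rewrite /decode; move: e => ->; rewrite asboolT.
Qed.

Definition kcode (c : cochains) (x : seq G) : code := encode (fun m => qz (c x m)).

Lemma kcodeE (c : cochains) x m : is_dual (c x) -> decode (kcode c x) m = qz (c x m).
Proof. by move=> dc; rewrite /kcode encodeK //; exact: is_char_dual. Qed.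

Lemma cont_cochainP q (c : cochains) :
  cont_cochain q c <-> cochain q c /\ locally_cst q (kcode c).
Proof.
split=> -[cc h]; split=> // x sx.
  apply: (popen_ext (h x sx)) => y sy; split=> [/qz_eqE e|e].
    by rewrite /kcode; congr encode; apply/funext.
  apply/qz_eqE => m; rewrite -!kcodeE ?e //; exact: cc.
apply: (popen_ext (h x sx)) => y sy; split=> [e|/qz_eqE e].
  apply/qz_eqE => m; rewrite -!kcodeE ?e //; exact: cc.
by rewrite /kcode; congr encode; apply/funext.
Qed.

Lemma simple_cont_cochain q (I : Type) (h : seq G -> I) (F : I -> M -> QZ) (c : cochains) :
  locally_cst q h -> (forall i, is_char (F i)) ->
  (forall x m, size x = q -> qz (c x m) = F (h x) m) -> cont_cochain q c.
Proof.
move=> lh cF cE; apply/cont_cochainP; split=> [x sx|].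
  by apply/is_dualE => m m'; rewrite !cE // cF.
have le : locally_cst q (fun x => encode (F (h x))).
  exact: (locally_cst_comp (r := fun i => encode (F i)) lh).
refine (locally_cst_ext _ le) => x sx.
by rewrite /kcode; congr encode; apply/funext => m; rewrite cE.
Qed.

Definition level (q : nat) (I : Type) (h : seq G -> I) (i : I) : set (seq G) :=
  [set x | size x = q /\ h x = i].

Lemma pchain0 q (mu : measure) : pchain q mu -> mu set0 = 0.
Proof.
move=> h; have c0 : pclopen q (set0 : set (seq G)).
  have -> : set0 = [set x : seq G | size x = q /\ False].
    by apply/seteqP; split=> // x [].
  apply: (@locally_cst_clopen _ _ unit (fun=> tt) (fun=> False)) => x sx.
  by apply: (popen_ext (@popenT G q)).
have := h _ _ c0 c0; rewrite setU0 setI0 => /(_ erefl) e.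
by apply: (addrI (mu set0)); rewrite -e addr0.
Qed.

Lemma pchain_push q (mu : measure) (I : finType) (h : seq G -> I) (P : pred I) :
  pchain q mu -> locally_cst q h ->
  mu [set x | size x = q /\ P (h x)] = \sum_(i | P i) mu (level q h i).
Proof.
move=> pm lh; rewrite -big_filter.
have -> : [set x | size x = q /\ P (h x)] =
    [set x | size x = q /\ h x \in [seq i <- index_enum I | P i]].
  by apply/seteqP; split=> x /=; rewrite mem_filter mem_index_enum andbT.
have : uniq [seq i <- index_enum I | P i] by rewrite filter_uniq // index_enum_uniq.
elim: [seq i <- index_enum I | P i] => [_|i r IH /= /andP[ir ur]].
  rewrite big_nil -[RHS](pchain0 pm); congr mu; apply/seteqP; split=> x //=.
  by rewrite in_nil => -[].
rewrite big_cons -(IH ur) -pm.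
- by congr mu; apply/seteqP; split=> x /=; rewrite inE;
    [move=> [sx /orP[/eqP|]]; [left|right]|move=> [[sx ->]|[sx ->]]; rewrite ?eqxx ?orbT].
- exact: (@locally_cst_clopen _ _ _ _ (fun j => j = i)).
- exact: (@locally_cst_clopen _ _ _ _ (fun j => j \in r)).
- by apply/seteqP; split=> x //= [[_ ->] [_ xr]]; move: ir; rewrite xr.
Qed.

(* The dual of [M] is finite, so a continuous cochain takes finitely many values
   modulo [Z] and its integral is a finite sum, without any compactness of [G]. *)
Definition pint (q : nat) (c : cochains) (mu : measure) : QZ :=
  \sum_(k : code) decode k (mu (level q (kcode c) k)).

(** The integral can be computed on any finite locally constant partition that determines the
    cochain modulo Z: pieces carrying the same character are merged by finite additivity. *)
Lemma pint_simple q (mu : measure) (I : finType) (h : seq G -> I) (F : I -> M -> QZ)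
    (c : cochains) : pchain q mu ->
  locally_cst q h -> (forall i, is_char (F i)) ->
  (forall x m, size x = q -> qz (c x m) = F (h x) m) ->
  pint q c mu = \sum_i F i (mu (level q h i)).
Proof.
move=> pm lh cF cE; rewrite /pint (partition_big (fun i => encode (F i)) xpredT) //=.
apply: eq_bigr => k _.
have -> : level q (kcode c) k = [set x | size x = q /\ encode (F (h x)) == k].
  apply/seteqP; split=> x /= [sx hx]; split=> //.
    by rewrite -hx; apply/eqP; congr encode; apply/funext => m; rewrite cE.
  by rewrite -(eqP hx); congr encode; apply/funext => m; rewrite cE.
rewrite (pchain_push (fun i => encode (F i) == k) pm lh) (char_sum (is_char_decode k)).
by apply: eq_bigr => i /eqP <-; rewrite encodeK.
Qed.

Lemma locally_cst_ffun q (J : finType) (I : Type) (h : J -> seq G -> I) :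
  (forall j, locally_cst q (h j)) -> locally_cst q (fun x => [ffun j => h j x]).
Proof.
move=> lh x sx.
have : popen q (fun y => forall j, j \in enum J -> h j y = h j x).
  by apply: popen_seq => j _; exact: lh.
move/popen_ext; apply=> y sy; split=> [e|/ffunP e j _].
  by apply/ffunP => j; rewrite !ffunE e // mem_enum.
by have := e j; rewrite !ffunE.
Qed.

(** The tuple of codes is a common refinement of the partitions attached to the [c j]. *)
Lemma simple_sum q (J : finType) (c : J -> cochains) (d : cochains) :
  (forall j, cont_cochain q (c j)) ->
  (forall x m, size x = q -> qz (d x m) = \sum_j qz (c j x m)) ->
  let h := fun x => [ffun j => kcode (c j) x] in
  [/\ locally_cst q h,
      forall k : {ffun J -> code}, is_char (fun m => \sum_j decode (k j) m),
      forall j x m, size x = q -> qz (c j x m) = decode (h x j) m &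
      forall x m, size x = q -> qz (d x m) = \sum_j decode (h x j) m].
Proof.
move=> cc dE h.
have cE j x m : size x = q -> qz (c j x m) = decode (h x j) m.
  by move=> sx; rewrite ffunE kcodeE //; apply (cc j).1.
split=> //.
- by apply: locally_cst_ffun => j; have /cont_cochainP[] := cc j.
- by move=> k m m'; rewrite -big_split; apply: eq_bigr => j _; exact: is_char_decode.
- by move=> x m sx; rewrite dE //; apply: eq_bigr => j _; rewrite cE.
Qed.

Lemma cont_cochain_sum q (J : finType) (c : J -> cochains) (d : cochains) :
  (forall j, cont_cochain q (c j)) ->
  (forall x m, size x = q -> qz (d x m) = \sum_j qz (c j x m)) -> cont_cochain q d.
Proof.
move=> cc dE; have [lh cF _ hd] := simple_sum cc dE.
exact: (simple_cont_cochain (F := fun (k : {ffun J -> code}) m => \sum_j decode (k j) m) lh cF hd).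
Qed.

Lemma pint_sum q (mu : measure) (J : finType) (c : J -> cochains) (d : cochains) :
  pchain q mu -> (forall j, cont_cochain q (c j)) ->
  (forall x m, size x = q -> qz (d x m) = \sum_j qz (c j x m)) ->
  pint q d mu = \sum_j pint q (c j) mu.
Proof.
move=> pm cc dE; have [lh cF hc hd] := simple_sum cc dE.
rewrite (pint_simple pm lh (F := fun (k : {ffun J -> code}) m => \sum_j decode (k j) m)) //.
rewrite exchange_big; apply: eq_bigr => j _.
rewrite (pint_simple pm lh (F := fun (k : {ffun J -> code}) m => decode (k j) m)) //; last exact: hc.
by move=> k; exact: is_char_decode.
Qed.

Lemma pintD q (mu : measure) (c c' d : cochains) :
  pchain q mu -> cont_cochain q c -> cont_cochain q c' ->
  (forall x m, size x = q -> qz (d x m) = qz (c x m) + qz (c' x m)) ->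
  pint q d mu = pint q c mu + pint q c' mu.
Proof.
move=> pm cc cc' dE.
rewrite (@pint_sum q mu bool (fun b => if b then c else c') d pm) ?big_bool //.
  by case.
by move=> x m sx; rewrite big_bool dE.
Qed.

Lemma cont_cochainB q (c c' : cochains) :
  cont_cochain q c -> cont_cochain q c' -> cont_cochain q (c - c').
Proof.
move=> /cont_cochainP[cc lc] /cont_cochainP[cc' lc'].
apply: (@simple_cont_cochain q _ _ (fun kk m => decode kk.1 m - decode kk.2 m) _
  (locally_cst_pair lc lc')) => [[k k'] m m' /=|x m sx].
  by rewrite !is_char_decode opprD addrACA.
by rewrite cochainBE raddfB /= !kcodeE //; [apply: cc'|apply: cc].
Qed.

Lemma cont_cochain0 q : cont_cochain q (0 : cochains).
Proof.
apply: (@simple_cont_cochain q unit (fun=> tt) (fun _ _ => 0)) => //.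
- by move=> x sx; apply: (popen_ext (@popenT G q)).
- by move=> _; exact: is_char0.
- by move=> x m _; rewrite raddf0.
Qed.

Lemma pintB q (mu : measure) (c c' : cochains) :
  pchain q mu -> cont_cochain q c -> cont_cochain q c' ->
  pint q (c - c') mu = pint q c mu - pint q c' mu.
Proof.
move=> pm cc cc'; apply/eqP; rewrite eq_sym subr_eq; apply/eqP.
apply: pintD => //; first exact: cont_cochainB.
by move=> x m _; rewrite cochainBE raddfB subrK.
Qed.

Lemma pint_ext q (mu : measure) (c c' : cochains) :
  (forall x m, size x = q -> qz (c x m) = qz (c' x m)) -> pint q c mu = pint q c' mu.
Proof.
move=> e; apply: eq_bigr => k _; congr (decode k (mu _)).
apply/seteqP; split=> x [sx <-]; split=> //;
  by rewrite /kcode; congr encode; apply/funext => m; rewrite e.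
Qed.

Lemma pint0 q (mu : measure) : pchain q mu -> pint q 0 mu = 0.
Proof.
move=> pm; have c0 := cont_cochain0 q.
by have := pintB pm c0 c0; rewrite !subrr.
Qed.

Lemma level_clopen q I (h : seq G -> I) i : locally_cst q h -> pclopen q (level q h i).
Proof. exact: (@locally_cst_clopen _ _ _ _ (fun j => j = i)). Qed.

Lemma pint_measure q (mu nu : measure) (c : cochains) : cont_cochain q c ->
  (forall A, pclopen q A -> mu A = nu A) -> pint q c mu = pint q c nu.
Proof.
move=> /cont_cochainP[_ lc] e; apply: eq_bigr => k _.
by rewrite e //; exact: level_clopen.
Qed.

Lemma pint_psub q (mu nu : measure) (c : cochains) :
  pint q c (psub mu nu) = pint q c mu - pint q c nu.
Proof.
rewrite /pint -sumrB; apply: eq_bigr => k _.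
by rewrite /psub is_char_decode charN //; exact: is_char_decode.
Qed.

(** Hence the passage from abstract to profinite chains respects the two pairings with continuous
    cochains. *)
Lemma pint_dirac q (c : cochains) (s : seq (seq G * M)) : cochain q c -> achain q s ->
  pint q c (dirac_chain s) = eval_chain c s.
Proof.
move=> cc sc; rewrite /pint /eval_chain.
transitivity (\sum_(k : code) \sum_(p <- s | kcode c p.1 == k) qz (c p.1 p.2)).
  apply: eq_bigr => k _; rewrite /dirac_chain (char_sum (is_char_decode k)).
  rewrite big_seq_cond [RHS]big_seq_cond; apply: eq_big => [p|p /andP[ps /asboolP[sp <-]]].
    case ps : (p \in s) => //=; apply/asboolP/eqP => [[]//|]; split=> //; exact: sc.
  by rewrite kcodeE //; exact: cc.
rewrite (exchange_big_dep xpredT) //=; apply: eq_bigr => p _.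
by rewrite (big_pred1 (kcode c p.1)) // => k; rewrite eq_sym.
Qed.

Definition step_cochain (f : M -> rat) (A : set (seq G)) : cochains :=
  fun x m => if `[< A x >] then f m else 0.

Definition step_char (f : M -> rat) (b : bool) : M -> QZ :=
  fun m => if b then qz (f m) else 0.

Lemma is_char_step f b : is_dual f -> is_char (step_char f b).
Proof.
by move=> df m m'; rewrite /step_char; case: b; rewrite ?addr0 // dualD.
Qed.

Lemma qz_step f A x m : qz (step_cochain f A x m) = step_char f `[< A x >] m.
Proof. by rewrite /step_cochain /step_char; case: ifP; rewrite ?raddf0. Qed.

Lemma cont_step q f A : is_dual f -> pclopen q A -> cont_cochain q (step_cochain f A).
Proof.
move=> df cA; apply: (simple_cont_cochain (clopen_locally_cst cA) (F := step_char f)).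
  by move=> b; exact: is_char_step.
by move=> x m _; rewrite qz_step.
Qed.

Lemma pint_step q (mu : measure) f A : pchain q mu -> is_dual f -> pclopen q A ->
  pint q (step_cochain f A) mu = qz (f (mu A)).
Proof.
move=> pm df cA.
rewrite (pint_simple pm (clopen_locally_cst cA) (F := step_char f)).
- rewrite big_bool /= addr0; congr (qz (f (mu _))).
  apply/seteqP; split=> x /=; first by move=> [_ /asboolW].
  by move=> Ax; split; [exact: cA.1|exact: asboolT].
- by move=> b; exact: is_char_step.
- by move=> x m _; rewrite qz_step.
Qed.
End Measures.

(** * Measures as the dual of the continuous cochains *)

Section ProfiniteChains.
Variables (G : profinite_group) (M : fin_gmodule G).
Local Notation "1g" := (pg_one G).
Local Notation act := (@gm_act G M).
Local Notation cochains := (seq G -> M -> rat).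
Local Notation measure := (set (seq G) -> M).
Local Notation N := (#|M|.-1).
Local Notation code := {ffun M -> 'I_N.+1}.
Local Notation is_act sg := (exists g : G, forall m, act (pg_inv g) m = sg m).

Lemma preim_clopen q' q (rho : seq G -> seq G) A : pcont q' q rho -> pclopen q A ->
  pclopen q' [set x | size x = q' /\ A (rho x)].
Proof.
move=> cr /clopen_locally_cst lA.
have := locally_cst_clopen (fun b => b = true) (locally_cst_preim cr lA).
congr pclopen; apply/seteqP; split=> x [sx] /=; first by move/asboolW.
by move/asboolT.
Qed.

Lemma head_clopen q (sg : {ffun M -> M}) A : pclopen q A ->
  pclopen q.+1 [set x | size x = q.+1 /\
    (forall m, act (pg_inv (nth 1g x 0)) m = sg m) /\ A (behead x)].
Proof.
move=> /clopen_locally_cst lA.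
have := locally_cst_clopen (fun p => p = (sg, true))
  (locally_cst_pair (@locally_cst_head_act G M q) (locally_cst_preim (pcont_behead G q) lA)).
congr pclopen; apply/seteqP; split=> x [sx] /=.
  by move=> [/ffunP e /asboolW Ax]; split=> //; split=> // m; rewrite -e ffunE.
move=> [e /asboolT ->]; split=> //; congr pair.
by apply/ffunP => m; rewrite ffunE.
Qed.

(** This serves the inner and the last faces, which carry only a sign; the first face also carries
    the action and is treated in [pint_head]. *)
Lemma pint_preim q' q rho n (c d : cochains) : pcont q' q rho -> cont_cochain q c ->
  (forall x m, size x = q' -> qz (d x m) = qz (c (rho x) (signm n m))) ->
  cont_cochain q' d /\ forall nu : measure, pchain q' nu ->
    pint q' d nu = \sum_(k : code)
      decode k (signm n (nu [set x | size x = q' /\ level q (kcode c) k (rho x)])).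
Proof.
move=> cr /cont_cochainP[cc lc] dE.
have lh := locally_cst_preim cr lc.
have cF (k : code) : is_char (fun m => decode k (signm n m)).
  exact: (char_signm (is_char_decode k) n).
have dF x m : size x = q' -> qz (d x m) = decode (kcode c (rho x)) (signm n m).
  by move=> sx; rewrite dE // kcodeE //; apply: cc; exact: cr.1.
split; first exact: (simple_cont_cochain (F := fun k m => decode k (signm n m)) lh cF dF).
move=> nu pn; rewrite (pint_simple pn lh (F := fun k m => decode k (signm n m))) //.
apply: eq_bigr => k _; congr (decode k (signm n (nu _))).
apply/seteqP; split=> x [sx]; last by case=> _ hx; split.
by move=> hx; split=> //; split=> //; exact: cr.1.
Qed.

Lemma pint_head q (c d : cochains) : cont_cochain q c ->
  (forall x m, size x = q.+1 ->
    qz (d x m) = qz (c (behead x) (act (pg_inv (nth 1g x 0)) m))) ->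
  cont_cochain q.+1 d /\ forall nu : measure, pchain q.+1 nu ->
    pint q.+1 d nu = \sum_(k : code) decode k
      (\sum_(sg : {ffun M -> M} | `[< is_act sg >])
        sg (nu [set x | size x = q.+1 /\ (forall m, act (pg_inv (nth 1g x 0)) m = sg m)
                       /\ level q (kcode c) k (behead x)])).
Proof.
move=> /cont_cochainP[cc lc] dE.
have lh := locally_cst_pair (@locally_cst_head_act G M q)
  (locally_cst_preim (pcont_behead G q) lc).
(* An arbitrary self-map of [M] need not be additive, so [F] is set to 0 off the maps given by
   elements of [G]. *)
pose F (p : {ffun M -> M} * code) : M -> QZ :=
  if `[< is_act p.1 >] then fun m => decode p.2 (p.1 m) else fun=> 0.
have cF p : is_char (F p).
  rewrite /F; case: asboolP => [[g hg] m m'|_]; last exact: is_char0.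
  by rewrite -!hg gm_actD is_char_decode.
have dF x m : size x = q.+1 -> qz (d x m) = F (head_act M x, kcode c (behead x)) m.
  move=> sx; rewrite dE // /F asboolT /=; last first.
    by exists (nth 1g x 0) => m'; rewrite ffunE.
  by rewrite ffunE kcodeE //; apply: cc; rewrite size_behead sx.
split; first exact: (simple_cont_cochain lh cF dF).
move=> nu pn; rewrite (pint_simple pn lh cF) //.
set h := fun x : seq G => (_, _).
transitivity (\sum_sg \sum_k F (sg, k) (nu (level q.+1 h (sg, k)))).
  by rewrite pair_bigA; apply: eq_bigr => -[].
rewrite exchange_big /=.
apply: eq_bigr => k _; rewrite (char_sum (is_char_decode k)) [RHS]big_mkcond /=.
apply: eq_bigr => sg _; rewrite /F /=; case: asboolP => // _.
congr (decode k (sg (nu _))); apply/seteqP; split=> x [sx].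
  case=> /ffunP e1 e2; split=> //; split; first by move=> m; rewrite -e1 ffunE.
  by split=> //; rewrite size_behead sx.
move=> [e1 [_ e2]]; split=> //; congr pair => //.
by apply/ffunP => m; rewrite ffunE.
Qed.

Lemma cobound_adjoint q (c : cochains) : cont_cochain q c ->
  cont_cochain q.+1 (cobound q c) /\ forall nu : measure, pchain q.+1 nu ->
    pint q.+1 (cobound q c) nu = pint q c (pbound q nu).
Proof.
move=> cc.
(* The [q + 2] faces: [inl] for the inner ones, [inr true] for the first, [inr false] for the
   last. *)
pose t (j : ('I_q + bool)%type) : cochains := fun x m => match j with
  | inl i => repr (qz (c (mergeg i x) (signm i.+1 m)))
  | inr true => c (behead x) (act (pg_inv (nth 1g x 0)) m)
  | inr false => c (take q x) (signm q.+1 m)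
  end.
have hm (i : 'I_q) := @pint_preim q.+1 q (mergeg i) i.+1 c (t (inl i))
  (@pcont_mergeg G _ _ (ltn_ord i)) cc (fun x m _ => qz_repr _).
have ht := @pint_preim q.+1 q (take q) q.+1 c (t (inr false))
  (pcont_take G q) cc (fun x m _ => erefl).
have hh := @pint_head q c (t (inr true)) cc (fun x m _ => erefl).
have ct j : cont_cochain q.+1 (t j).
  by case: j => [i|[]]; [exact: (hm i).1|exact: hh.1|exact: ht.1].
have dE x m : size x = q.+1 -> qz (cobound q c x m) = \sum_j qz (t j x m).
  move=> sx; rewrite qz_cobound //; last exact: cc.1.
  rewrite big_sumType big_bool /= addrCA addrA; congr (_ + _ + _).
  by apply: eq_bigr => i _; rewrite qz_repr.
split; first exact: cont_cochain_sum ct dE.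
move=> nu pn; rewrite (pint_sum pn ct dE) big_sumType big_bool /=.
rewrite hh.2 // ht.2 // addrCA addrA.
under eq_bigr => i _ do rewrite (hm i).2 //.
rewrite exchange_big -!big_split; apply: eq_bigr => k _ /=.
by rewrite -(char_sum (is_char_decode k)) -!is_char_decode.
Qed.

Lemma pchain_pbound q (nu : measure) : pchain q.+1 nu -> pchain q (pbound q nu).
Proof.
move=> pn A B cA cB AB.
have disj (T : set (seq G)) rho : (T `&` [set x | A (rho x)]) `&` (T `&` [set x | B (rho x)]) = set0.
  apply/seteqP; split=> // x [[_ Ax] [_ Bx]].
  by have : (A `&` B) (rho x) by []; rewrite AB.
have addp (T : seq G -> Prop) rho :
    pclopen q.+1 [set x | T x /\ A (rho x)] -> pclopen q.+1 [set x | T x /\ B (rho x)] ->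
    nu [set x | T x /\ (A `|` B) (rho x)] =
    nu [set x | T x /\ A (rho x)] + nu [set x | T x /\ B (rho x)].
  move=> c1 c2; rewrite -pn //; last exact: (disj [set x | T x] rho).
  congr nu; apply/seteqP; split=> x /=.
    by case=> Tx [?|?]; [left|right].
  by case=> -[Tx ?]; split=> //; [left|right].
have signmD n (m m' : M) : signm n (m + m') = signm n m + signm n m'.
  by rewrite /signm; case: ifP => // _; rewrite opprD.
rewrite /pbound.
rewrite (eq_bigr (fun sg : {ffun M -> M} =>
    sg (nu [set x | size x = q.+1 /\ (forall m, act (pg_inv (nth 1g x 0)) m = sg m)
                       /\ A (behead x)]) +
    sg (nu [set x | size x = q.+1 /\ (forall m, act (pg_inv (nth 1g x 0)) m = sg m)
                       /\ B (behead x)]))); last first.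
  move=> sg /asboolP[g hg].
  have assoc C : [set x | size x = q.+1 /\ (forall m, act (pg_inv (nth 1g x 0)) m = sg m)
        /\ C (behead x)] =
      [set x | (size x = q.+1 /\ (forall m, act (pg_inv (nth 1g x 0)) m = sg m))
        /\ C (behead x)].
    by apply/seteqP; split=> x /=; tauto.
  have := head_clopen sg cA; have := head_clopen sg cB.
  rewrite !assoc => c2 c1; rewrite (addp _ _ c1 c2).
  by rewrite -!hg gm_actD.
rewrite big_split /= (addp _ _ (preim_clopen (pcont_take G q) cA) (preim_clopen (pcont_take G q) cB)) signmD.
rewrite (eq_bigr (fun i : 'I_q => signm i.+1 (nu [set x | size x = q.+1 /\ A (mergeg i x)]) +
    signm i.+1 (nu [set x | size x = q.+1 /\ B (mergeg i x)]))); last first.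
  move=> i _; rewrite -signmD.
  by rewrite (addp _ _ (preim_clopen (@pcont_mergeg G _ _ (ltn_ord i)) cA) (preim_clopen (@pcont_mergeg G _ _ (ltn_ord i)) cB)).
by rewrite big_split /= [X in X + _ = _]addrACA [LHS]addrACA.
Qed.

(** Step cochains integrate to the characters of [mu A], and characters separate [M]. *)
Lemma measure_eq q (mu nu : measure) : pchain q mu -> pchain q nu ->
  (forall c, cont_cochain q c -> pint q c mu = pint q c nu) ->
  forall A, pclopen q A -> mu A = nu A.
Proof.
move=> pm pn e A cA; apply: char_separated => u cu.
pose f m : rat := repr (u m).
have df : is_dual f by apply/is_dualE => m m'; rewrite !qz_repr cu.
have := e _ (cont_step df cA).
by rewrite !pint_step // !qz_repr.
Qed.

(** For clopen [A], applying [phi] to step cochains supported on [A] gives a character of the dual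
    of [M], which by biduality is evaluation at a point, taken as [mu A]. A continuous cochain is
    modulo Z the sum of its steps over its level sets. *)
Lemma measure_char q (phi : {additive cochains -> QZ}) :
  (forall c, cont_cochain q c -> (forall x m, size x = q -> qz (c x m) = 0) -> phi c = 0) ->
  exists mu : measure, pchain q mu /\ forall c, cont_cochain q c -> pint q c mu = phi c.
Proof.
move=> phi0.
pose S A (u : M -> QZ) : cochains := step_cochain (fun m => repr (u m)) A.
have SE A u x m : qz (S A u x m) = if `[< A x >] then u m else 0.
  by rewrite qz_step /step_char; case: ifP; rewrite ?qz_repr.
have dS u : is_char u -> is_dual (fun m => repr (u m)).
  by move=> cu; apply/is_dualE => m m'; rewrite !qz_repr cu.
have cS A u : pclopen q A -> is_char u -> cont_cochain q (S A u).
  by move=> cA cu; apply: cont_step => //; exact: dS.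
have phi_ext c c' : cont_cochain q c -> cont_cochain q c' ->
    (forall x m, size x = q -> qz (c x m) = qz (c' x m)) -> phi c = phi c'.
  move=> cc cc' e; apply/eqP; rewrite -subr_eq0 -raddfB; apply/eqP; apply: phi0.
    exact: cont_cochainB.
  by move=> x m sx; rewrite cochainBE raddfB /= e // subrr.
have charB u v : is_char u -> is_char v -> is_char (u - v).
  move=> cu cv m m'; transitivity (u (m + m') - v (m + m')) => //.
  by rewrite cu cv opprD addrACA.
have hmu A : exists m, pclopen q A -> forall u, is_char u -> phi (S A u) = u m.
  case: (pselect (pclopen q A)) => [cA|]; last by exists 0.
  have [|m hm] := @biduality G M (fun u => phi (S A u)); last by exists m.
  move=> u v cu cv; rewrite -raddfB; apply: phi_ext.
  - by apply: cS => //; exact: charB.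
  - by apply: cont_cochainB; exact: cS.
  - move=> x m sx; rewrite cochainBE raddfB /= !SE; case: ifP => // _.
    by rewrite subr0.
have [mu muE] := choice hmu; exists mu; split.
  move=> A B cA cB AB; apply: char_separated => u cu.
  have cAB : pclopen q (A `|` B).
    have := locally_cst_clopen (fun p => p.1 || p.2 = true)
      (locally_cst_pair (clopen_locally_cst cA) (clopen_locally_cst cB)).
    congr pclopen; apply/seteqP; split=> x /=.
      by move=> [_ /orP[]/asboolW]; [left|right].
    case=> h; (split; first by [exact: cA.1|exact: cB.1]).
      by rewrite (asboolT h).
    by rewrite (asboolT h) orbT.
  have : phi (S (A `|` B) u - S A u) = phi (S B u).
    apply: phi_ext; [by apply: cont_cochainB; exact: cS|exact: cS|].
    move=> x m sx; rewrite cochainBE raddfB /= !SE.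
    case: (asboolP (A x)) => Ax; case: (asboolP (B x)) => Bx.
    - by have : (A `&` B) x by []; rewrite AB.
    - by rewrite asboolT ?subrr //; left.
    - by rewrite asboolT ?subr0 //; right.
    - by rewrite asboolF ?subr0 //; case.
  by rewrite raddfB /= !muE // cu => <-; rewrite addrC subrK.
move=> c cc; have /cont_cochainP[cc1 lc] := cc.
have cl k := level_clopen k lc.
pose T k := S (level q (kcode c) k) (decode k).
have cT k : cont_cochain q (T k) by apply: cS => //; exact: is_char_decode.
have sumE x m : (\sum_k T k) x m = \sum_k T k x m.
  exact: (big_morph (fun d : cochains => d x m)).
have TE x m : size x = q -> qz (c x m) = \sum_k qz (T k x m).
  move=> sx; rewrite (bigD1 (kcode c x)) //= big1 ?addr0 => [|k nk].
    by rewrite SE asboolT // kcodeE //; exact: cc1.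
  by rewrite SE asboolF // => -[_ e]; move: nk; rewrite e eqxx.
transitivity (\sum_k phi (T k)).
  by apply: eq_bigr => k _; rewrite muE //; exact: is_char_decode.
rewrite -raddf_sum; apply: phi_ext => //.
  by apply: (cont_cochain_sum cT) => x m _; rewrite sumE raddf_sum.
by move=> x m sx; rewrite TE // sumE raddf_sum.
Qed.
End ProfiniteChains.

(** * The pairing between cohomology and homology *)

Section Duality.
Variables (G : profinite_group) (M : fin_gmodule G) (q : nat).
Local Notation cochains := (seq G -> M -> rat).
Local Notation measure := (set (seq G) -> M).
Local Notation coefs := (seq G -> M).
Local Notation N := (#|M|.-1).

(** Cochains are rational representatives, so one that vanishes modulo Z on [G^q] is a zero class
    without being the function 0. *)
Lemma null_coboundary (P : nat -> cochains -> Prop) (c : cochains) : (forall p, P p 0) ->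
  (forall x m, size x = q -> qz (c x m) = 0) -> coboundary P q c.
Proof.
move=> P0; case: q => [|p] h.
  by move=> x sx; apply/qz_eqE => m; rewrite raddf0 h.
exists 0; split=> // x sx; apply/qz_eqE => m; rewrite h //.
by rewrite -(subrr (0 : cochains)) coboundB subrr raddf0.
Qed.

Lemma coboundaryB (P : nat -> cochains -> Prop) (c c' : cochains) :
  (forall p b b', P p b -> P p b' -> P p (b - b')) ->
  coboundary P q c -> coboundary P q c' -> coboundary P q (c - c').
Proof.
move=> PB; case: q => [|p] /=.
  move=> h h' x sx; apply/qz_eqE => m.
  have /qz_eqE e := h x sx; have /qz_eqE e' := h' x sx.
  by rewrite cochainBE raddfB /= e e' subrr raddf0.
move=> [b [Pb h]] [b' [Pb' h']]; exists (b - b'); split; first exact: PB.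
move=> x sx; apply/qz_eqE => m; rewrite coboundB !cochainBE !raddfB /=.
by have /qz_eqE -> := h x sx; have /qz_eqE -> := h' x sx.
Qed.

Lemma cocycleB (c c' : cochains) : cocycle q c -> cocycle q c' -> cocycle q (c - c').
Proof.
move=> h h' x sx; apply/qz_eqE => m; rewrite coboundB cochainBE raddfB /=.
have /qz_eqE -> := h x sx; have /qz_eqE -> := h' x sx.
by rewrite /= (raddf0 qz) subrr.
Qed.

Lemma cocycle0 : cocycle q (0 : cochains).
Proof.
move=> x sx; apply/qz_eqE => m.
by rewrite -(subrr (0 : cochains)) coboundB subrr.
Qed.

Definition cont_cocycles : set cochains :=
  [set c | cont_cochain q c /\ cocycle q c].
(** Membership in [cont_cocycles] is included since [coboundary] constrains values only modulo Z and
    in degree [q]; the inclusion asked by [is_pairing] then holds by definition. *)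
Definition cont_coboundaries : set cochains :=
  [set c | cont_cocycles c /\ coboundary (@cont_cochain G M) q c].

Lemma subgroup_cont_cocycles : subgroup cont_cocycles.
Proof.
split; first by split; [exact: cont_cochain0|exact: cocycle0].
by move=> c c' [h z] [h' z']; split; [exact: cont_cochainB|exact: cocycleB].
Qed.

Lemma coboundary_cont0 : coboundary (@cont_cochain G M) q 0.
Proof.
apply: null_coboundary => [p|x m _]; first exact: cont_cochain0.
by rewrite raddf0.
Qed.

Lemma coboundary_contB (c c' : cochains) :
  coboundary (@cont_cochain G M) q c -> coboundary (@cont_cochain G M) q c' ->
  coboundary (@cont_cochain G M) q (c - c').
Proof. by apply: coboundaryB => p b b'; exact: cont_cochainB. Qed.

Lemma subgroup_cont_coboundaries : subgroup cont_coboundaries.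
Proof.
split; first by split; [exact: subgroup_cont_cocycles.1|exact: coboundary_cont0].
move=> c c' [h z] [h' z']; split; first exact: subgroup_cont_cocycles.2.
exact: coboundary_contB.
Qed.

Lemma pint_coboundary (mu : measure) (c : cochains) : pcycle q mu ->
  coboundary (@cont_cochain G M) q c -> pint q c mu = 0.
Proof.
case: q => [[pm _] h|p [pm z] [b [cb h]]].
  rewrite -(pint0 pm); apply: pint_ext => x m sx.
  by have /qz_eqE -> := h x sx.
rewrite (pint_ext mu (c' := cobound p b)) => [|x m sx]; last first.
  by have /qz_eqE -> := h x sx.
rewrite (cobound_adjoint cb).2 //.
transitivity (pint p b (fun=> 0 : M)); first exact: pint_measure.
by apply: big1 => k _; apply: char0; exact: is_char_decode.
Qed.

(** Conversely, if [mu] kills cocycles, sending the coboundary of [c] to the integral of [c] is well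
    defined; a measure representing an extension has boundary [mu], by adjunction. *)
Lemma pboundaryP (mu : measure) : pchain q mu ->
  pboundary q mu <-> forall c, cont_cocycles c -> pint q c mu = 0.
Proof.
move=> pm; split=> [[nu [pn h]] c [cc zc]|h].
  rewrite (pint_measure cc h) -(cobound_adjoint cc).2 // -(pint0 pn).
  apply: pint_ext => x m sx.
  by have /qz_eqE -> := zc x sx.
(* The domain holds every function that agrees with a coboundary modulo Z, so that the extension
   kills null cochains, as [measure_char] demands. *)
have gR : is_graph [set r : cochains * QZ | exists c, [/\ cont_cochain q c,
    forall x m, size x = q.+1 -> qz (r.1 x m) = qz (cobound q c x m) &
    r.2 = pint q c mu]].
  split; first split.
  - exists 0; split; [exact: cont_cochain0| |by rewrite pint0].
    by move=> x m sx; have /qz_eqE -> := cocycle0 sx.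
  - move=> [d s] [d' s'] [c [/= cc e ->]] [c' [/= cc' e' ->]].
    exists (c - c'); split=> /=; [exact: cont_cochainB| |by rewrite pintB].
    by move=> x m sx; rewrite coboundB !cochainBE !raddfB /= e ?e'.
  - move=> t [c [/= cc e ->]]; apply: h; split=> // x sx.
    by apply/qz_eqE => m; exact: esym (e x m sx).
have [F hF] := char_ext gR.
have [nu [pn nuF]] : exists nu : measure, pchain q.+1 nu /\
    forall c, cont_cochain q.+1 c -> pint q.+1 c nu = F c.
  apply: measure_char => c cc c0; apply: hF.
  exists 0; split=> /=; [exact: cont_cochain0| |by rewrite pint0].
  by move=> x m sx; rewrite c0 //; have /qz_eqE -> := cocycle0 sx; rewrite raddf0.
exists nu; split=> //; apply: measure_eq => //; first exact: pchain_pbound.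
move=> c cc; have [cdc adj] := cobound_adjoint cc.
rewrite -adj // nuF //; symmetry; apply: hF.
by exists c.
Qed.

(** Prescribing [phi] on cocycles and 0 on coboundaries gives a measure; by adjunction the zero
    values on coboundaries say that its boundary vanishes. *)
Lemma cocycle_char (phi : {additive cochains -> QZ}) :
  (forall c, cont_coboundaries c -> phi c = 0) ->
  exists mu : measure, pcycle q mu /\ forall c, cont_cocycles c -> pint q c mu = phi c.
Proof.
move=> phiB.
have gR : is_graph [set r : cochains * QZ | exists c d, [/\ cont_cocycles c,
    cont_cochain q d, coboundary (@cont_cochain G M) q d & r = (c + d, phi c)]].
  split; first split.
  - exists 0, 0; split; [exact: subgroup_cont_cocycles.1|exact: cont_cochain0|
      exact: coboundary_cont0|by rewrite raddf0 addr0].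
  - move=> _ _ [c [d [zc cd bd ->]]] [c' [d' [zc' cd' bd' ->]]].
    exists (c - c'), (d - d'); split; [exact: subgroup_cont_cocycles.2|
      exact: cont_cochainB|exact: coboundary_contB|].
    by congr pair; rewrite /= ?raddfB // opprD addrACA.
  - move=> t [c [d [zc cd bd [e ->]]]]; apply: phiB; split=> //.
    have -> : c = 0 - d by apply/eqP; rewrite eq_sym subr_eq -e.
    exact: coboundary_contB coboundary_cont0 bd.
have [F hF] := char_ext gR.
have FB d : cont_cochain q d -> coboundary (@cont_cochain G M) q d -> F d = 0.
  move=> cd bd; apply: hF; exists 0, d; split=> //; first exact: subgroup_cont_cocycles.1.
  by rewrite add0r raddf0.
have [mu [pm muF]] : exists mu : measure, pchain q mu /\
    forall c, cont_cochain q c -> pint q c mu = F c.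
  apply: measure_char => c cc c0; apply: FB => //.
  by apply: null_coboundary => // p; exact: cont_cochain0.
exists mu; split; last first.
  move=> c zc; rewrite muF; last exact: zc.1.
  apply: hF; exists c, 0; split=> //; [exact: cont_cochain0|exact: coboundary_cont0|].
  by rewrite addr0.
split=> //; case: q pm muF FB => // p pm muF FB A cA.
have p0 : pchain p ((fun=> 0) : measure) by move=> ? ? ? ? _; rewrite addr0.
apply: (measure_eq (pchain_pbound pm) p0) cA => c cc.
have [cdc adj] := cobound_adjoint cc.
rewrite -adj // muF // FB //; last by exists c; split=> // x sx; apply/qz_eqE.
by rewrite /pint big1 // => k _; apply: char0; exact: is_char_decode.
Qed.

Lemma pchain_psub (mu nu : measure) : pchain q mu -> pchain q nu -> pchain q (psub mu nu).
Proof.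
by move=> pm pn A B cA cB AB; rewrite /psub pm // pn // opprD addrACA.
Qed.

Lemma psub_pboundaryP (mu nu : measure) : pchain q mu -> pchain q nu ->
  pboundary q (psub mu nu) <-> forall c, cont_cocycles c -> pint q c mu = pint q c nu.
Proof.
move=> pm pn; rewrite (pboundaryP (pchain_psub pm pn)).
by split=> h c zc; have := h c zc; rewrite pint_psub => /eqP;
  [rewrite subr_eq0 => /eqP|move=> e; apply/eqP; rewrite subr_eq0].
Qed.

Lemma pchain_dirac (s : seq (seq G * M)) : pchain q (dirac_chain s).
Proof.
move=> A B _ _ AB; rewrite /dirac_chain !(big_mkcond (fun p => `[< _ >])) -big_split.
apply: eq_bigr => p _ /=.
case: (asboolP (A p.1)) => Ax; case: (asboolP (B p.1)) => Bx.
- by have : (A `&` B) p.1 by []; rewrite AB.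
- by rewrite asboolT ?addr0 //; left.
- by rewrite asboolT ?add0r //; right.
- by rewrite asboolF ?addr0 //; case.
Qed.

Lemma pcycle_char (mu : measure) : pcycle q mu -> exists phi : {additive cochains -> QZ},
  (forall c, cont_coboundaries c -> phi c = 0) /\
  forall c, cont_cocycles c -> phi c = pint q c mu.
Proof.
move=> zm; have pm := zm.1.
have [c c' [cc _] [cc' _]|phi hphi] := @extend_on _ _ (fun c => pint q c mu) subgroup_cont_cocycles.
  exact: pintB.
exists phi; split=> // c [zc bc]; rewrite hphi //.
exact: pint_coboundary.
Qed.

(* Independent of the representing chain by [eval_chain_coef]. *)
Definition coef_pair (c : cochains) (y : coefs) : QZ :=
  eval_chain c (xget [::] [set s | achain q s /\ acoef s = y]).

Lemma coef_pairE c s : cochain q c -> achain q s -> coef_pair c (acoef s) = eval_chain c s.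
Proof.
move=> cc sc; rewrite /coef_pair.
have [ac e] : [set s' | achain q s' /\ acoef s' = acoef s]
    (xget [::] [set s' | achain q s' /\ acoef s' = acoef s]).
  by apply: xgetPex; exists s.
exact: (eval_chain_coef cc ac sc e).
Qed.

Lemma coef_pairing : is_pairing coef_pair cont_cocycles cont_coboundaries
  (@cycle_coefs G M q) (@boundary_coefs G M q) N.
Proof.
split.
- exact: subgroup_cont_cocycles.
- exact: subgroup_cont_coboundaries.
- exact: subgroup_cycle_coefs.
- exact: subgroup_boundary_coefs.
- by move=> c [].
- by move=> y [s [zs _ e]]; exists s.
- move=> y [s [zs <-]] c c' [[cc _] _] [[cc' _] _].
  rewrite !coef_pairE ?eval_chainB //; try exact: zs.1.
  exact: cochainB.
- move=> c [[cc _] _] y y' [s [zs <-]] [s' [zs' <-]].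
  rewrite -acoef_aneg -acoef_cat !coef_pairE //; try exact: zs.1; try exact: zs'.1.
    by rewrite eval_chain_cat (eval_chain_aneg cc zs'.1).
  by apply: achain_cat; [exact: zs.1|apply: achain_aneg; exact: zs'.1].
- move=> c y [[[cc _] zc] bc] [s [zs <-]]; rewrite coef_pairE //; last exact: zs.1.
  apply: eval_chain_coboundary zs; move: bc; case: q => // p [b [[cb _] h]].
  by exists b.
- move=> c y [[cc _] zc] [s [zs bs <-]]; rewrite coef_pairE //; last exact: zs.1.
  exact: eval_chain_aboundary zs.1 bs.
(* The multiple by |M| vanishes only modulo Z, so it is shown to be a coboundary; on the homology
   side the multiple is 0 itself. *)
- move=> c zc; split; first exact: (subgroupMn subgroup_cont_cocycles).
  apply: null_coboundary => [p|x m sx]; first exact: cont_cochain0.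
  have -> : (c *+ N.+1) x m = c x m *+ N.+1.
    by elim: N.+1 => [|n IH] //; rewrite !mulrS -IH.
  rewrite raddfMn; apply: (@char_tors _ _ (fun m => qz (c x m))).
  by apply: is_char_dual; exact: zc.1.1.
- move=> y _; have -> : y *+ N.+1 = 0; last exact: (subgroup_boundary_coefs _ _).1.
  apply/funext => x; rewrite -[RHS](cardM_tors (y x)).
  by elim: N.+1 => [|n IH] //; rewrite !mulrS -IH.
Qed.

(** Abstract cocycles up to coboundary are the characters of cycles modulo boundaries: existence is
    [cycle_char], uniqueness [orth_cycles_coboundary]. *)
Lemma coh_surjP : coh_surj M q <->
  adj_surj coef_pair cont_cocycles (@cycle_coefs G M q) (@boundary_coefs G M q).
Proof.
split=> [h phi phiB|h c cc zc].
  have [c [cc zc cE]] := cycle_char phiB.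
  have [c' [cc' [zc' bc]]] := h c cc zc; exists c'; split=> // y [s [zs <-]].
  rewrite coef_pairE //; [|exact: cc'.1|exact: zs.1].
  have := eval_chain_coboundary bc zs; rewrite -[subc c c']/(c - c') eval_chainB.
  by move/eqP; rewrite subr_eq0 => /eqP <-; exact: cE.
have [||phi phiE] := @extend_on _ (@cycle_coefs G M q) (coef_pair c).
- exact: subgroup_cycle_coefs.
- move=> y y' [s [zs <-]] [s' [zs' <-]].
  rewrite -acoef_aneg -acoef_cat !coef_pairE //; try exact: zs.1; try exact: zs'.1.
    by rewrite eval_chain_cat (eval_chain_aneg cc zs'.1).
  by apply: achain_cat; [exact: zs.1|apply: achain_aneg; exact: zs'.1].
have [|c' [[cc' zc'] h']] := h phi.
  move=> y [s [zs bs <-]]; rewrite phiE; last by exists s.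
  by rewrite coef_pairE //; [exact: eval_chain_aboundary zs.1 bs|exact: zs.1].
exists c'; split=> //; split=> //; apply: orth_cycles_coboundary.
  exact: (cochainB cc cc'.1).
move=> s zs; rewrite -[subc c c']/(c - c') eval_chainB.
have zy : cycle_coefs q (acoef s) by exists s.
have := h' _ zy; rewrite phiE // !coef_pairE //; try exact: zs.1; try exact: cc'.1.
by move=> ->; rewrite subrr.
Qed.

Lemma coh_injP : coh_inj M q <->
  adj_inj coef_pair cont_cocycles cont_coboundaries (@cycle_coefs G M q).
Proof.
split=> [h c [cc zc] h0|h c cc zc bc].
  split=> //; apply: h => //; apply: orth_cycles_coboundary; first exact: cc.1.
  move=> s zs; rewrite -coef_pairE; [|exact: cc.1|exact: zs.1].
  by apply: h0; exists s.
apply: (h c _ _).2 => // y [s [zs <-]].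
rewrite coef_pairE; [|exact: cc.1|exact: zs.1].
exact: eval_chain_coboundary bc zs.
Qed.

Lemma hom_injP : hom_inj M q <-> adj_inj (fun y c => coef_pair c y)
  (@cycle_coefs G M q) (@boundary_coefs G M q) cont_cocycles.
Proof.
split=> [h y [s [zs <-]] h0|h s zs bs].
  exists s; split=> //; apply: h => //.
  apply/(pboundaryP (pchain_dirac s)) => c zc.
  rewrite pint_dirac; [|exact: zc.1.1|exact: zs.1].
  by rewrite -coef_pairE; [exact: h0|exact: zc.1.1|exact: zs.1].
have [|c zc|s' [zs' bs' e]] := h (acoef s); first by exists s.
  rewrite coef_pairE; [|exact: zc.1.1|exact: zs.1].
  rewrite -(pint_dirac zc.1.1 zs.1).
  exact: (pboundaryP (pchain_dirac s)).1.
exact: aboundary_coef e bs'.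
Qed.

(** Profinite cycles up to boundary are the characters of continuous cocycles modulo coboundaries,
    by [cocycle_char] and [psub_pboundaryP]; the finiteness condition translates by the same
    dictionary. *)
Lemma hom_surjP : hom_surj M q <-> adj_surj (fun y c => coef_pair c y)
  (@cycle_coefs G M q) cont_cocycles cont_coboundaries.
Proof.
split=> [h phi phiB|h mu zm].
  have [mu [zm muE]] := cocycle_char phiB.
  have [s [zs bs]] := h mu zm; exists (acoef s); split; first by exists s.
  move=> c zc; rewrite coef_pairE; [|exact: zc.1.1|exact: zs.1].
  rewrite -(pint_dirac zc.1.1 zs.1) -muE //; symmetry.
  exact: (psub_pboundaryP zm.1 (pchain_dirac s)).1.
have [phi [phiB phiE]] := pcycle_char zm.
have [y [[s [zs <-]] hs]] := h phi phiB; exists s; split=> //.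
apply/(psub_pboundaryP zm.1 (pchain_dirac s)) => c zc.
rewrite pint_dirac; [|exact: zc.1.1|exact: zs.1].
by rewrite -phiE // -hs // coef_pairE; [|exact: zc.1.1|exact: zs.1].
Qed.

Lemma hom_c_finiteP : hom_c_finite M q <-> finite_dual cont_cocycles cont_coboundaries.
Proof.
split=> [[n [L [zL hL]]]|[I [L [LB hL]]]].
  have [phi hphi] := choice (fun i : 'I_n => pcycle_char (zL i (ltn_ord i))).
  exists 'I_n, phi; split=> [i|psi psiB]; first exact: (hphi i).1.
  have [mu [zm muE]] := cocycle_char psiB.
  have [i ilt bi] := hL mu zm; exists (Ordinal ilt) => c zc.
  rewrite (hphi _).2 // -muE //.
  exact: (psub_pboundaryP zm.1 (zL i ilt).1).1.
have [mu hmu] := choice (fun i => cocycle_char (LB i)).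
exists #|I|, (fun k => nth (fun=> 0) [seq mu i | i <- enum I] k).
have nthE k (hk : (k < #|I|)%N) : exists i,
    nth (fun=> 0) [seq mu i | i <- enum I] k = mu i.
  have [i0 _] : exists i0, i0 \in I by apply/card_gt0P; exact: leq_ltn_trans hk.
  by exists (nth i0 (enum I) k); rewrite (nth_map i0) // -cardE.
split=> [k /nthE[i ->]|nu zn]; first exact: (hmu i).1.
have [phi [phiB phiE]] := pcycle_char zn.
have [i hi] := hL phi phiB; exists (index i (enum I)).
  by rewrite cardE index_mem mem_enum.
rewrite (nth_map i) ?index_mem ?mem_enum // nth_index ?mem_enum //.
apply/(psub_pboundaryP zn.1 (hmu i).1.1) => c zc.
by rewrite (hmu i).2 // -phiE // hi.
Qed.
End Duality.

Theorem theorem2p4 (G : profinite_group) (M : fin_gmodule G) (q : nat) :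
  (* (i) *)
  (coh_surj M q -> hom_inj M q) /\ (hom_surj M q -> coh_inj M q) /\
  (* (ii): any two of the three conditions imply the third *)
  let hom_iso := hom_inj M q /\ hom_surj M q in
  let coh_iso := coh_inj M q /\ coh_surj M q in
  let fin := hom_c_finite M q in
  (hom_iso -> coh_iso -> fin) /\ (hom_iso -> fin -> coh_iso) /\ (coh_iso -> fin -> hom_iso).
Proof.
have pr := coef_pairing M q.
rewrite /= coh_surjP coh_injP hom_injP hom_surjP hom_c_finiteP.
have inj_hom := surj_inj pr; have inj_coh := surj_inj (pairing_flip pr).
split=> //; split=> //; split; last split.
- by move=> [_ sY] [_ sX]; exact: (surj_finite pr sX sY).
- by move=> [iY sY] fin; split; [exact: inj_coh|exact: (finite_surj_l pr iY fin)].
- by move=> [iX sX] fin; split; [exact: inj_hom|exact: (finite_surj_r pr iX fin)].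
Qed.
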